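(* Let $\Theta\subseteq\mathbb{R}^d$ be bounded, let $\{p_\theta:\theta\in\Theta\}$ be a family of densities on $\mathbb{R}^p$ with respect to a common reference measure $\mu$, and let $\mathcal{G}$ be the set of all probability distributions supported on $\Theta$. Let $g_0\in\mathcal{G}$ be not finitely discrete (i.e. not a discrete distribution with a finite number of mass points), and assume that for $g\in\mathcal{G}$ one has $\chi(f_g,f_{g_0})=0$ if and only if $g=g_0$. Let $X_1,X_2,\dots$ be i.i.d. with density $f_{g_0}$. Then $$L_n(\mathcal{G},g_0)=\sup_{g\in\mathcal{G}}\ell_n(f_g)-\ell_n(f_{g_0})\to\infty\quad\text{in probability},$$ i.e. $\mathbb{P}(L_n(\mathcal{G},g_0)>M)\to1$ as $n\to\infty$ for every $M>0$.
   Context: For $g\in\mathcal{G}$, $f_g(x)=\int_\Theta p_\theta(x)\,\mathrm{d}g(\theta)$, where $(x,\theta)\mapsto p_\theta(x)$ is jointly measurable so that this is a well-defined density with respect to $\mu$. The log-likelihood is $\ell_n(f)=\sum_{i=1}^n\log f(X_i)$. For densities $f,f_0$ with respect to $\mu$, $\chi(f,f_0)=\|f/f_0-1\|_{L_2(f_0\,\mathrm{d}\mu)}\in[0,\infty]$. If $L_n(\mathcal{G},g_0)$ is not measurable, $\mathbb{P}$ is to be read as inner probability. *)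

(* Defs.v *)
From HB Require Import structures.
From mathcomp Require Export all_boot all_order all_algebra finmap.
From mathcomp Require Export all_classical all_reals all_analysis.
Export Order.TTheory GRing.Theory Num.Theory numFieldNormedType.Exports.

Set Implicit Arguments.
Unset Strict Implicit.
Unset Printing Implicit Defensive.

Local Open Scope classical_set_scope.
Local Open Scope ring_scope.
Local Open Scope ereal_scope.

(* R^n with its Borel sigma-algebra. *)
Notation borelRV R n := (g_sigma_algebraType (@open 'rV[R]_n)).

(* [Theta] as a measurable space in its own right, carrying the trace of the
   Borel sigma-algebra: [Theta] itself need not be a Borel set.  Measurable
   types are pointed in the library, hence the nonemptiness argument. *)
Definition points_of (T : choiceType) (A : set T) (A0 : A !=set0) : Type :=
  set_type A.

HB.instance Definition _ (T : choiceType) (A : set T) (A0 : A !=set0) :=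
  Choice.copy (points_of A0) (set_type A).
HB.instance Definition _ (T : choiceType) (A : set T) (A0 : A !=set0) :=
  isPointed.Build (points_of A0)
    (exist (fun x => x \in A) (projT1 (cid A0)) (mem_set (projT2 (cid A0)))).

Definition point_val (R : realType) (d : nat) (Theta : set 'rV[R]_d)
  (Theta0 : Theta !=set0) : points_of Theta0 -> borelRV R d := fun t => \val t.

Notation paramType Theta0 :=
  (g_sigma_algebra_preimageType (@point_val _ _ _ Theta0)).

Section mixtures.
Context (R : realType) (d1 d2 : measure_display).
Context (T : measurableType d1) (S : measurableType d2).

(* A measure of the library is a function on all sets, whose values on
   non-measurable sets are irrelevant: Leibniz equality would be too fine. *)
Definition same_law (g h : probability T R) : Prop :=
  forall A, measurable A -> g A = h A.

Definition finitely_discrete (g : probability T R) : Prop :=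
  exists2 F : set T, finite_set F & g F = 1.

Definition is_density (mu : {measure set S -> \bar R}) (f : S -> R) : Prop :=
  [/\ measurable_fun setT f, forall x, (0 <= f x)%R
    & \int[mu]_x (f x)%:E = 1].

Definition mixture (p : T -> S -> R) (g : probability T R) (x : S) : \bar R :=
  \int[g]_t (p t x)%:E.

(* The L2-norm of f / f0 - 1 for the measure f0 dmu.  Points with f0 x = 0
   contribute 0, since y * 0 = 0 for every extended real y. *)
Definition chi (mu : {measure set S -> \bar R}) (f f0 : S -> \bar R) : \bar R :=
  (\int[mu]_x (`|f x / f0 x - 1| `^ 2 * f0 x)) `^ 2^-1.

End mixtures.

Section samples.
Context (R : realType) (d1 d2 d3 : measure_display).
Context (T : measurableType d1) (S : measurableType d2).
Context (Omega : measurableType d3) (P : probability Omega R).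
Variable X : nat -> Omega -> S.

Definition mutually_independent : Prop :=
  forall (J : {fset nat}) (A : nat -> set S),
    (forall i, measurable (A i)) ->
    P (\bigcap_(i in [set` J]) (X i @^-1` A i)) =
    \prod_(i <- J) P (X i @^-1` A i).

Definition has_density (mu : {measure set S -> \bar R}) (f : S -> \bar R)
    (Y : Omega -> S) : Prop :=
  forall A, measurable A -> P (Y @^-1` A) = \int[mu]_(x in A) f x.

Definition iid_with_density (mu : {measure set S -> \bar R})
    (f : S -> \bar R) : Prop :=
  [/\ forall i, measurable_fun setT (X i), forall i, has_density mu f (X i)
    & mutually_independent].

Definition loglik (f : S -> \bar R) (n : nat) (w : Omega) : \bar R :=
  \sum_(i < n) lne (f (X i w)).

Definition loglik_ratio (p : T -> S -> R) (g0 : probability T R)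
    (n : nat) (w : Omega) : \bar R :=
  ereal_sup (range (fun g : probability T R => loglik (mixture p g) n w))
  - loglik (mixture p g0) n w.

Definition inner_probability (A : set Omega) : \bar R :=
  ereal_sup [set P B | B in [set B | measurable B /\ B `<=` A]].

Lemma inner_probability_measurable (A : set Omega) :
  measurable A -> inner_probability A = P A.
Proof.
move=> mA; apply/eqP; rewrite eq_le; apply/andP; split.
- by apply: ge_ereal_sup => _ [B [mB BA] <-]; apply: le_measure; rewrite ?inE.
- by apply: ereal_sup_ubound; exists A => //; split.
Qed.

End samples.

(* Main.v *)
(** The law [g0] charges disjoint sets [A_0, ..., A_K] of parameters. Tilting
    [g0] to [(1 + sum_k t_k phi_k) dg0], with [phi_k] built from the indicators of
    the [A_k], stays inside the class of mixing laws, and turns the likelihood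
    ratio of one observation into [1 + sum_k t_k z_k(x)], where
    [z_k(x) = E(phi_k | x)] is a posterior mean, bounded and centered. By
    identifiability [phi |-> z] is injective, so Gram-Schmidt makes
    [z_0, ..., z_(K-1)] orthonormal in [L^2(f_g0 dmu)]. With
    [S = sum_i z(X_i)] and [t = S / 8n] the log-likelihood ratio is at least
    [|S|^2 / 16n] once the empirical Gram matrix is close to the identity, and
    [|S|^2 / n] has mean [K] and variance at most [2K + O(1/n)]; Chebyshev makes
    it at least [K / 2] with probability [1 - O(1/K)], for arbitrary [K]. *)
From HB Require Import structures.
Require Import Defs.
From mathcomp Require Import measurable_realfun ring lra.

Set Implicit Arguments.
Unset Strict Implicit.
Unset Printing Implicit Defensive.

Local Open Scope classical_set_scope.
Local Open Scope ring_scope.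

(** * Bounded measurable functions and their means *)

(** Boundedness is what makes the tilt admissible. The coordinates of [S / 8n] are of order
    [1 / sqrt n] on the good event, so with bounded [phi_k] the tilt is at most [1/2] in absolute
    value for large [n], uniformly in the parameter and in the observation: the tilted weights stay
    nonnegative and the logarithm can be expanded to second order. The posterior means inherit the
    bound, so all moments exist. The choices come in a fixed order: [K] from the level and the error
    probability, then the scores with their bounds, and only then [n]. The tilt depends on the
    sample, but the supremum over mixing laws is taken sample by sample. The lower bound is
    therefore deterministic on a measurable event, which is all that an inner probability asks for.
    Since [mu] need not be sigma-finite, integrals are exchanged only between [g0] and the law [Q]
    of one observation, both probabilities. *)

Definition bounded_mfun d (T : measurableType d) (R : realType) (f : T -> R) :=
  measurable_fun setT f /\ exists B, forall x, `|f x| <= B.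

Section bounded_mfun.
Context d (T : measurableType d) (R : realType).
Implicit Types f g : T -> R.

Lemma bounded_mfun_cst (c : R) : bounded_mfun (fun _ : T => c).
Proof. by split; [exact: measurable_cst|exists `|c|]. Qed.

Lemma bounded_mfunD f g :
  bounded_mfun f -> bounded_mfun g -> bounded_mfun (fun x => f x + g x).
Proof.
move=> [mf [A fA]] [mg [B gB]]; split; first exact: measurable_funD.
by exists (A + B) => x; rewrite (le_trans (ler_normD _ _))// lerD.
Qed.

Lemma bounded_mfunM f g :
  bounded_mfun f -> bounded_mfun g -> bounded_mfun (fun x => f x * g x).
Proof.
move=> [mf [A fA]] [mg [B gB]]; split; first exact: measurable_funM.
by exists (A * B) => x; rewrite normrM ler_pM.
Qed.

Lemma bounded_mfunZ c f : bounded_mfun f -> bounded_mfun (fun x => c * f x).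
Proof. by move=> bf; apply: bounded_mfunM => //; exact: bounded_mfun_cst. Qed.

Lemma bounded_mfunB f g :
  bounded_mfun f -> bounded_mfun g -> bounded_mfun (fun x => f x - g x).
Proof.
move=> bf bg; apply: bounded_mfunD => //.
rewrite (_ : (fun x => - g x) = (fun x => -1 * g x)); first exact: bounded_mfunZ.
by apply/funext => x; rewrite mulN1r.
Qed.

Lemma bounded_mfunX f n : bounded_mfun f -> bounded_mfun (fun x => f x ^+ n).
Proof.
move=> bf; elim: n => [|n ih].
  by under eq_fun do rewrite expr0; exact: bounded_mfun_cst.
by under eq_fun do rewrite exprS; exact: bounded_mfunM.
Qed.

Lemma bounded_mfun_sum I (r : seq I) (f : I -> T -> R) :
  (forall i, bounded_mfun (f i)) -> bounded_mfun (fun x => \sum_(i <- r) f i x).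
Proof.
move=> bf; elim: r => [|i r ih].
  by under eq_fun do rewrite big_nil; exact: bounded_mfun_cst.
by under eq_fun do rewrite big_cons; exact: bounded_mfunD.
Qed.

Lemma bounded_mfun_indic (A : set T) :
  measurable A -> bounded_mfun (\1_A : T -> R).
Proof.
move=> mA; split; first exact: measurable_indic.
by exists 1 => x; rewrite indicE; case: (_ \in _); rewrite ?normr1 ?normr0.
Qed.

Lemma bounded_mfun_comp d' (T' : measurableType d') (X : T' -> T) f :
  measurable_fun setT X -> bounded_mfun f -> bounded_mfun (fun x => f (X x)).
Proof.
move=> mX [mf [B fB]]; split; first exact: measurableT_comp.
by exists B.
Qed.

End bounded_mfun.

Section mean.
Context d (T : measurableType d) (R : realType) (P : probability T R).
Implicit Types f g : T -> R.

Lemma bounded_mfun_integrable f :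
  bounded_mfun f -> P.-integrable setT (EFin \o f).
Proof.
move=> [mf [B fB]]; apply: measurable_bounded_integrable => //.
  by rewrite [X in (X < _)%E](@probability_setT _ _ _ P) ltry.
by exists B; split=> [|M BM x _]; [exact: num_real|exact: le_trans (fB x) (ltW BM)].
Qed.

Lemma fin_num_integral_bounded f : bounded_mfun f ->
  (\int[P]_x (f x)%:E)%E \is a fin_num.
Proof. by move=> /bounded_mfun_integrable; exact: integrable_fin_num. Qed.

Lemma mean_cst (c : R) : \int[P]_x c = c.
Proof. by rewrite Rintegral_cst// [X in fine X](@probability_setT _ _ _ P) mulr1. Qed.

Lemma meanD f g : bounded_mfun f -> bounded_mfun g ->
  \int[P]_x (f x + g x) = \int[P]_x f x + \int[P]_x g x.
Proof. by move=> bf bg; apply: RintegralD => //; exact: bounded_mfun_integrable. Qed.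

Lemma meanB f g : bounded_mfun f -> bounded_mfun g ->
  \int[P]_x (f x - g x) = \int[P]_x f x - \int[P]_x g x.
Proof. by move=> bf bg; apply: RintegralB => //; exact: bounded_mfun_integrable. Qed.

Lemma meanZ c f : bounded_mfun f -> \int[P]_x (c * f x) = c * \int[P]_x f x.
Proof. by move=> bf; apply: RintegralZl => //; exact: bounded_mfun_integrable. Qed.

Lemma mean_sum I (r : seq I) (f : I -> T -> R) :
  (forall i, bounded_mfun (f i)) ->
  \int[P]_x (\sum_(i <- r) f i x) = \sum_(i <- r) \int[P]_x f i x.
Proof.
move=> bf; elim: r => [|i r ih].
  by under eq_Rintegral do rewrite big_nil; rewrite big_nil mean_cst.
under eq_Rintegral do rewrite big_cons.
by rewrite big_cons meanD ?ih//; exact: bounded_mfun_sum.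
Qed.

Lemma mean_le f g : bounded_mfun f -> bounded_mfun g ->
  (forall x, f x <= g x) -> \int[P]_x f x <= \int[P]_x g x.
Proof.
by move=> bf bg fg; apply: le_Rintegral => //; exact: bounded_mfun_integrable.
Qed.

Lemma mean_ge0 f : (forall x, 0 <= f x) -> 0 <= \int[P]_x f x.
Proof. by move=> f0; exact: Rintegral_ge0. Qed.

Lemma mean_indic A : measurable A -> \int[P]_x (\1_A x) = fine (P A).
Proof. by move=> mA; rewrite /Rintegral integral_indic// setIT. Qed.

Lemma mean_markov f : bounded_mfun f -> (forall x, 0 <= f x) ->
  (P [set x | (1 <= f x)%R] <= (\int[P]_x f x)%:E)%E.
Proof.
move=> bf f0.
have mA : measurable [set x | 1 <= f x].
  rewrite -[X in measurable X]setTI.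
  have -> : [set x | 1 <= f x] = f @^-1` `[1, +oo[.
    by apply/seteqP; split => x /=; rewrite in_itv/= andbT.
  exact: bf.1.
rewrite -[X in (X <= _)%E]fineK ?fin_num_measure// lee_fin -mean_indic//.
apply: mean_le => //; first exact: bounded_mfun_indic.
move=> x; rewrite indicE; case: (boolP (x \in _)) => //.
by rewrite inE.
Qed.

Lemma mean_sqr_eq0 f : bounded_mfun f -> \int[P]_x (f x ^+ 2) = 0 ->
  P [set x | f x != 0] = 0%E.
Proof.
move=> bf.
have bf2 := bounded_mfunX 2 bf.
have ff := fin_num_integral_bounded bf2.
move=> /eqP; rewrite /Rintegral fine_eq0// => /eqP f20.
have := ae_eq_integral_abs P measurableT (f := EFin \o (fun x => f x ^+ 2)).
case=> [|+ _]; first by apply/measurable_EFinP; exact: bf2.1.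
case.
  rewrite -[RHS]f20; apply: eq_integral => x _ /=.
  by rewrite ger0_norm// sqr_ge0.
move=> N [mN PN sub].
have mA : measurable [set x | f x != 0].
  rewrite (_ : [set x | _] = f @^-1` (~` [set 0])).
    rewrite -[X in measurable X]setTI; apply: bf.1 => //.
    exact: measurableC.
  by apply/seteqP; split => x /= /eqP.
apply/eqP; rewrite -measure_le0 -PN; apply: le_measure; rewrite ?inE//.
move=> x /= fx; apply: sub => /= /(_ I) [] /eqP.
by rewrite sqrf_eq0 (negbTE fx).
Qed.

Lemma mean_ae_eq0 f N : bounded_mfun f -> measurable N -> P N = 0%E ->
  (forall x, ~ N x -> f x = 0) -> \int[P]_x f x = 0.
Proof.
move=> bf mN PN fN; rewrite /Rintegral (ae_eq_integral (cst 0%E))//=.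
- by rewrite integral0.
- by apply/measurable_EFinP; exact: bf.1.
- exists N; split => // x /= H; apply: contrapT => Nx; apply: H => _.
  by rewrite fN.
Qed.

End mean.

Lemma mean_distribution d d' (T : measurableType d) (T' : measurableType d')
  (R : realType) (P : probability T R) (X : {mfun T >-> T'}) (f : T' -> R) :
  bounded_mfun f -> \int[distribution P X]_x f x = \int[P]_x f (X x).
Proof.
move=> bf; rewrite /Rintegral (@integral_distribution _ _ _ _ _ P X (EFin \o f))//.
  by apply/measurable_EFinP; exact: bf.1.
have := @bounded_mfun_integrable _ _ _ P (f \o X).
by apply; exact: bounded_mfun_comp.
Qed.

(** * Independence *)

Section product_rule.
Context (R : realType) (d1 d2 : measure_display).
Context (T : measurableType d1) (S : measurableType d2) (P : probability T R).
Variables (G : set (set T)) (Y : {mfun T >-> S}).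
Hypothesis Gm : forall B, <<s G >> B -> measurable B.
Hypothesis PG : forall B A, <<s G >> B -> measurable A ->
  P (B `&` Y @^-1` A) = (P B * P (Y @^-1` A))%E.

Let subT : measurableType _ := g_sigma_algebraType G.

Let measurable_id_sub : measurable_fun setT (id : T -> subT).
Proof. by move=> _ B mB; rewrite setTI; exact: Gm. Qed.

Lemma bounded_mfun_sub (f : T -> R) :
  bounded_mfun (f : subT -> R) -> bounded_mfun f.
Proof. by move=> /(bounded_mfun_comp measurable_id_sub). Qed.

Let idsub : {mfun T >-> subT} := HB.pack (id : T -> subT)
  (isMeasurableFun.Build _ _ _ _ (id : T -> subT) measurable_id_sub).

Let pairsub (w : T) : subT * S := (w, Y w).

Let measurable_pairsub : measurable_fun setT pairsub.
Proof. exact: (@measurable_fun_pair _ _ _ T subT S id Y). Qed.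

Let pairm : {mfun T >-> (subT * S)%type} := HB.pack pairsub
  (isMeasurableFun.Build _ _ _ _ pairsub measurable_pairsub).

(** Typing [f] on [subT] expresses measurability for the sub-sigma-algebra. The product rule for
    events says that the joint law of the identity into [subT] and of [Y] is a product measure, and
    Fubini then yields the rule for functions. *)
Lemma mean_prod (f : T -> R) (a : S -> R) :
  bounded_mfun (f : subT -> R) -> bounded_mfun a ->
  \int[P]_w (f w * a (Y w)) = (\int[P]_w f w) * \int[P]_w a (Y w).
Proof.
move=> bf ba.
pose PG' := distribution P idsub; pose PY := distribution P Y.
pose h (z : subT * S) := f z.1 * a z.2.
have bh : bounded_mfun h.
  apply: bounded_mfunM.
    exact: (bounded_mfun_comp (@measurable_fst _ _ subT S) bf).
  exact: (bounded_mfun_comp (@measurable_snd _ _ subT S) ba).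
transitivity (\int[distribution P pairm]_z h z).
  by rewrite mean_distribution.
transitivity (\int[(PG' \x PY)%E]_z h z).
  rewrite /Rintegral; congr fine; apply: eq_measure_integral => A mA _.
  rewrite -(@product_measure_unique _ _ _ _ _ PG' PY (distribution P pairm))//.
rewrite [LHS]/Rintegral -integral12_prod_meas1; last first.
  exact: bounded_mfun_integrable bh.
rewrite /fubini_F.
have E x : (\int[PY]_y (h (x, y))%:E)%E = ((\int[P]_w a (Y w)) * f x)%:E.
  rewrite /h/=; under eq_integral do rewrite EFinM.
  rewrite integralZl//; last exact: bounded_mfun_integrable.
  rewrite mulrC EFinM -(@mean_distribution _ _ _ _ _ P Y)//.
  by rewrite [in RHS]/Rintegral fineK//; exact: fin_num_integral_bounded.
transitivity (\int[PG']_x ((\int[P]_w a (Y w)) * f x)).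
  by rewrite /Rintegral; congr fine; apply: eq_integral => x _; exact: E.
rewrite meanZ// mulrC; congr (_ * _).
exact: (@mean_distribution _ _ _ _ _ P idsub).
Qed.

End product_rule.

Section independence.
Context (R : realType) (d1 d2 : measure_display).
Context (T : measurableType d1) (S : measurableType d2) (P : probability T R).
Variable X : nat -> {mfun T >-> S}.
Hypothesis indX : mutually_independent P (fun i => X i : T -> S).

(** Cylinders rather than single preimages: they form a pi-system, as uniqueness of measures
    requires, and generate the sigma-algebra of the first [n] observations. *)
Definition past (n : nat) : set (set T) :=
  [set \bigcap_(i < n) X i @^-1` A i | A in [set A | forall i, measurable (A i)]].

Local Notation pastT n := (g_sigma_algebraType (past n)).

Lemma sigma_past_measurable n B : <<s past n >> B -> measurable B.
Proof.
apply: smallest_sub; first exact: sigma_algebra_measurable.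
move=> _ [A mA <-]; apply: bigcap_measurableType => i _.
by rewrite -[X in measurable X]setTI; exact: measurable_funP.
Qed.

Lemma independence_ord (A : nat -> set S) n : (forall i, measurable (A i)) ->
  P (\bigcap_(i < n) X i @^-1` A i) = (\prod_(i < n) P (X i @^-1` A i))%E.
Proof.
move=> mA; have := indX [fset i | i in iota 0 n]%fset mA.
have -> : [set` [fset i | i in iota 0 n]%fset] = `I_n.
  apply/seteqP; split => i /=; first by move/imfsetP => [j /= + ->]; rewrite mem_iota.
  by move=> ni; apply/imfsetP; exists i => //=; rewrite mem_iota.
move=> ->; rewrite -(big_mkord xpredT (fun i => P (X i @^-1` A i))).
rewrite /index_iota subn0; apply: perm_big; apply: uniq_perm.
- exact: fset_uniq.
- exact: iota_uniq.
move=> i; apply/idP/idP; first by move/imfsetP => [j /= + ->].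
by move=> ni; apply/imfsetP; exists i.
Qed.

(** For fixed [A] both sides are finite measures in [B], namely a restriction and a multiple of [P];
    they agree on cylinders, hence on the generated sigma-algebra. *)
Lemma sigma_past_indep n B A : <<s past n >> B -> measurable A ->
  P (B `&` X n @^-1` A) = (P B * P (X n @^-1` A))%E.
Proof.
move=> pB mA.
have mXA : measurable (X n @^-1` A).
  by rewrite -[X in measurable X]setTI; exact: measurable_funP.
have c0 : 0 <= fine (P (X n @^-1` A)) by exact: fine_ge0.
have cE D : mscale (NngNum c0) P D = (P D * P (X n @^-1` A))%E.
  by rewrite /mscale/= fineK ?fin_num_measure// muleC.
rewrite -cE -[LHS]/(mrestr P mXA B).
apply: (@g_sigma_algebra_measure_unique _ R T (past n) _ (fun=> setT)) pB.
- by move=> C pC; apply: (@sigma_past_measurable n); exact: sub_sigma_algebra.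
- move=> _; exists (fun=> setT) => //.
  by apply/seteqP; split.
- by apply/seteqP; split => // x _; exists 0%N.
- move=> _ _ [C mC <-] [D mD <-]; exists (fun i => C i `&` D i).
    by move=> i; exact: measurableI.
  by rewrite -bigcapI; apply: eq_bigcapr => i _; rewrite preimage_setI.
- move=> _ [C mC <-]; rewrite /= [RHS]cE /mrestr.
  (* The cylinder constrains only indices below [n], so slot [n] is free to hold [A]. *)
  pose D i := if i == n then A else C i.
  have mD i : measurable (D i) by rewrite /D; case: ifP.
  have -> : \bigcap_(i < n) X i @^-1` C i `&` X n @^-1` A =
            \bigcap_(i < n.+1) X i @^-1` D i.
    apply/seteqP; split => [x [xC xA] i /=|x xD]; rewrite /D.
      rewrite ltnS leq_eqVlt => /orP[/eqP ->|ni]; first by rewrite eqxx.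
      by rewrite ltn_eqF//; exact: xC.
    split => [i /= ni|]; last by have := xD n (ltnSn n); rewrite /D eqxx.
    by have := xD i (ltnW ni); rewrite /D ltn_eqF.
  rewrite independence_ord// big_ord_recr/= /D eqxx; congr (_ * _)%E.
  rewrite independence_ord//; apply: eq_bigr => i _.
  by rewrite ltn_eqF.
- by move=> _; rewrite /= /mrestr setTI (le_lt_trans (probability_le1 P mXA))// ltry.
Qed.

Lemma mean_past n (f : T -> R) (a : S -> R) :
  bounded_mfun (f : pastT n -> R) -> bounded_mfun a ->
  \int[P]_w (f w * a (X n w)) = (\int[P]_w f w) * \int[P]_w a (X n w).
Proof.
apply: mean_prod; first exact: sigma_past_measurable.
exact: sigma_past_indep.
Qed.

Lemma measurable_fun_past n i :
  (i < n)%N -> measurable_fun setT (X i : pastT n -> S).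
Proof.
move=> ni _ B mB; rewrite setTI; apply: sub_sigma_algebra.
exists (fun j => if j == i then B else setT) => [j|]; first by case: ifP.
apply/seteqP; split => [x /(_ i ni)|x Bx j _ /=]; first by rewrite eqxx.
by case: ifPn => // /eqP ->.
Qed.

Definition psum (a : S -> R) n w : R := \sum_(i < n) a (X i w).

Lemma psumS a n w : psum a n.+1 w = psum a n w + a (X n w).
Proof. by rewrite /psum big_ord_recr. Qed.

Lemma psum_past a n : bounded_mfun a -> bounded_mfun (psum a n : pastT n -> R).
Proof.
move=> ba; apply: bounded_mfun_sum => i.
by apply: bounded_mfun_comp => //; exact: measurable_fun_past.
Qed.

Lemma bounded_mfun_past n (f : T -> R) :
  bounded_mfun (f : pastT n -> R) -> bounded_mfun f.
Proof. by apply: bounded_mfun_sub => B; exact: sigma_past_measurable. Qed.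

Lemma bounded_mfun_psum a n : bounded_mfun a -> bounded_mfun (psum a n).
Proof. by move=> /(@psum_past a n); exact: bounded_mfun_past. Qed.

Variable Q : probability S R.
Hypothesis XQ : forall i A, measurable A -> P (X i @^-1` A) = Q A.

Lemma mean_obs i (a : S -> R) :
  bounded_mfun a -> \int[P]_w a (X i w) = \int[Q]_x a x.
Proof.
move=> ba; rewrite -mean_distribution//; congr fine.
by apply: eq_measure_integral => A mA _; exact: XQ.
Qed.

Lemma mean_psum a n : bounded_mfun a ->
  \int[P]_w psum a n w = n%:R * \int[Q]_x a x.
Proof.
move=> ba; rewrite mean_sum; last by move=> i; exact: bounded_mfun_comp.
under eq_bigr do rewrite mean_obs//.
by rewrite sumr_const card_ord mulr_natl.
Qed.

Lemma mean_psum_sqr a n : bounded_mfun a -> \int[Q]_x a x = 0 ->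
  \int[P]_w (psum a n w ^+ 2) = n%:R * \int[Q]_x (a x ^+ 2).
Proof.
move=> ba a0; elim: n => [|n ih].
  by under eq_Rintegral do rewrite /psum big_ord0 expr0n/=; rewrite mean_cst mul0r.
have bX := bounded_mfun_comp (@measurable_funPT _ _ _ _ (X n)) ba.
have bS := bounded_mfun_psum n ba.
have bSX := bounded_mfunM bS bX.
under eq_Rintegral do rewrite psumS sqrrD -[_ *+ 2]mulr_natl.
rewrite meanD; last 2 first.
- apply: bounded_mfunD; first exact: bounded_mfunX.
  exact: (bounded_mfunZ 2%:R bSX).
- exact: (bounded_mfunX 2 bX).
rewrite (mean_obs n (bounded_mfunX 2 ba)) meanD; last 2 first.
- exact: bounded_mfunX.
- exact: bounded_mfunZ.
rewrite ih meanZ//.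
rewrite (mean_past (psum_past n ba) ba) (mean_obs n ba) a0 !mulr0 addr0.
by rewrite -natr1 mulrDl mul1r.
Qed.

End independence.

(** * Moments of sums of orthonormal scores *)

(** Shaped for [sqdevS]: [f] is the past value, [2 g + h] the increment. *)
Lemma mean_sqrD3 d (T : measurableType d) (R : realType) (P : probability T R)
    (f g h : T -> R) : bounded_mfun f -> bounded_mfun g -> bounded_mfun h ->
  \int[P]_x ((f x + 2%:R * g x + h x) ^+ 2) =
  \int[P]_x (f x ^+ 2) + 4%:R * \int[P]_x (g x ^+ 2) + \int[P]_x (h x ^+ 2)
  + 4%:R * \int[P]_x (f x * g x) + 2%:R * \int[P]_x (f x * h x)
  + 4%:R * \int[P]_x (g x * h x).
Proof.
move=> bf bg bh.
have b2 := bounded_mfunX 2 bf; have c2 := bounded_mfunX 2 bg.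
have e2 := bounded_mfunX 2 bh.
have bfg := bounded_mfunM bf bg; have bfh := bounded_mfunM bf bh.
have bgh := bounded_mfunM bg bh.
rewrite (@eq_Rintegral _ _ _ _ _ (fun x => f x ^+ 2 + 4%:R * g x ^+ 2 + h x ^+ 2
  + 4%:R * (f x * g x) + 2%:R * (f x * h x) + 4%:R * (g x * h x))); last first.
  by move=> x _; ring.
have b4c := bounded_mfunZ 4%:R c2; have b4fg := bounded_mfunZ 4%:R bfg.
have b2fh := bounded_mfunZ 2%:R bfh; have b4gh := bounded_mfunZ 4%:R bgh.
have s1 := bounded_mfunD b2 b4c; have s2 := bounded_mfunD s1 e2.
have s3 := bounded_mfunD s2 b4fg; have s4 := bounded_mfunD s3 b2fh.
by rewrite (meanD P s4 b4gh) (meanD P s3 b2fh) (meanD P s2 b4fg) (meanD P s1 e2)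
  (meanD P b2 b4c) !meanZ.
Qed.

Section moments.
Context (R : realType) (d1 d2 : measure_display).
Context (T : measurableType d1) (S : measurableType d2) (P : probability T R).
Variable X : nat -> {mfun T >-> S}.
Hypothesis indX : mutually_independent P (fun i => X i : T -> S).
Variable Q : probability S R.
Hypothesis XQ : forall i A, measurable A -> P (X i @^-1` A) = Q A.
Variables (K : nat) (z : 'I_K -> S -> R).
Hypothesis bz : forall k, bounded_mfun (z k).
Hypothesis z0 : forall k, \int[Q]_x z k x = 0.
Hypothesis zz : forall k l, \int[Q]_x (z k x * z l x) = (k == l)%:R.

(** [|S|^2] minus its mean: a martingale for the filtration of the observations. *)
Definition sqdev n w : R := \sum_(k < K) psum X (z k) n w ^+ 2 - (n * K)%:R.

Definition sqdev1 x : R := \sum_(k < K) z k x ^+ 2 - K%:R.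

Lemma bounded_sqdev1 : bounded_mfun sqdev1.
Proof.
apply: bounded_mfunB; last exact: bounded_mfun_cst.
by apply: bounded_mfun_sum => k; exact: bounded_mfunX.
Qed.

Lemma mean_sqdev1 : \int[Q]_x sqdev1 x = 0.
Proof.
have b2 k : bounded_mfun (fun x => z k x ^+ 2) by exact: bounded_mfunX.
rewrite meanB; last 2 first.
- exact: bounded_mfun_sum.
- exact: bounded_mfun_cst.
rewrite mean_cst mean_sum//.
under eq_bigr do (under eq_Rintegral do rewrite expr2; rewrite zz eqxx).
by rewrite sumr_const card_ord subrr.
Qed.

Lemma bounded_sqdev n :
  bounded_mfun (sqdev n : g_sigma_algebraType (past X n) -> R).
Proof.
apply: bounded_mfunB; last exact: bounded_mfun_cst.
by apply: bounded_mfun_sum => k; apply: bounded_mfunX; exact: psum_past.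
Qed.

Lemma sqdevS n w : sqdev n.+1 w = sqdev n w +
  2%:R * (\sum_(k < K) psum X (z k) n w * z k (X n w)) + sqdev1 (X n w).
Proof.
rewrite /sqdev /sqdev1 mulSn natrD.
under eq_bigr do rewrite psumS sqrrD -[_ *+ 2]mulr_natl.
rewrite !big_split/= mulr_sumr.
ring.
Qed.

(** Step [n] adds [4nK] plus the second moment of [sqdev1], all cross terms being zero; summing [4K]
    times [0, ..., n-1] gives [2Kn(n-1)]. *)
Lemma mean_sqdev_sqr n : \int[P]_w (sqdev n w ^+ 2) =
  2%:R * K%:R * (n%:R * (n%:R - 1)) + n%:R * \int[Q]_x (sqdev1 x ^+ 2).
Proof.
have b1 := bounded_sqdev1.
elim: n => [|n ih].
  under eq_Rintegral => w _.
    rewrite /sqdev mul0n subr0 big1 => [|k _]; last by rewrite /psum big_ord0 expr0n.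
    rewrite expr0n/=.
    over.
  by rewrite mean_cst mul0r mulr0 mul0r addr0.
pose L w := \sum_(k < K) psum X (z k) n w * z k (X n w).
have bV := bounded_sqdev n.
have bVT := bounded_mfun_past bV.
have bS k := psum_past X n (bz k).
have bST k := bounded_mfun_past (bS k).
have bzX k := bounded_mfun_comp (@measurable_funPT _ _ _ _ (X n)) (bz k).
have bSz k := bounded_mfunM (bST k) (bzX k).
have bL : bounded_mfun L by exact: bounded_mfun_sum.
have bq := bounded_mfun_comp (@measurable_funPT _ _ _ _ (X n)) b1.
under eq_Rintegral do rewrite sqdevS.
rewrite (mean_sqrD3 P bVT bL bq) ih.
have -> : \int[P]_w (L w ^+ 2) = n%:R * K%:R.
  under eq_Rintegral => w _ do rewrite expr2 /L mulr_suml.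
  rewrite mean_sum; last first.
    by move=> k; apply: bounded_mfunM => //; exact: bounded_mfun_sum.
  rewrite (eq_bigr (fun=> n%:R)); last first.
    move=> k _; under eq_Rintegral => w _ do rewrite mulr_sumr.
    rewrite mean_sum; last by move=> l; exact: bounded_mfunM.
    rewrite (bigD1 k)//= big1 => [|l lk].
      under eq_Rintegral do rewrite mulrACA.
      rewrite (mean_past indX (bounded_mfunM (bS k) (bS k)) (bounded_mfunM (bz k) (bz k))).
      rewrite (mean_obs XQ n (bounded_mfunM (bz k) (bz k))) zz eqxx mulr1 addr0.
      under eq_Rintegral do rewrite -expr2.
      rewrite (mean_psum_sqr indX XQ)//.
      by under eq_Rintegral do rewrite expr2; rewrite zz eqxx mulr1.
    under eq_Rintegral do rewrite mulrACA.
    rewrite (mean_past indX (bounded_mfunM (bS k) (bS l)) (bounded_mfunM (bz k) (bz l))).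
    by rewrite (mean_obs XQ n (bounded_mfunM (bz k) (bz l))) zz eq_sym (negbTE lk) mulr0.
  by rewrite sumr_const card_ord mulr_natr.
have -> : \int[P]_w (sqdev n w * L w) = 0.
  under eq_Rintegral => w _ do rewrite /L mulr_sumr.
  rewrite mean_sum; last by move=> l; exact: bounded_mfunM.
  rewrite big1// => k _; under eq_Rintegral do rewrite mulrA.
  by rewrite (mean_past indX (bounded_mfunM bV (bS k)) (bz k)) (mean_obs XQ)// z0 mulr0.
have -> : \int[P]_w (sqdev n w * sqdev1 (X n w)) = 0.
  by rewrite (mean_past indX bV b1) (mean_obs XQ)// mean_sqdev1 mulr0.
(* The third-order moments of the scores, in [z k * sqdev1], need not vanish; here it is the factor
   from the past, [psum], that has mean zero. *)
have -> : \int[P]_w (L w * sqdev1 (X n w)) = 0.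
  under eq_Rintegral => w _ do rewrite /L mulr_suml.
  rewrite mean_sum; last by move=> l; exact: bounded_mfunM.
  rewrite big1// => k _; under eq_Rintegral do rewrite -mulrA.
  rewrite (mean_past indX (bS k) (bounded_mfunM (bz k) b1)).
  by rewrite (mean_psum XQ)// z0 mulr0 mul0r.
rewrite (mean_obs XQ n (bounded_mfunX 2 b1)) -natr1.
ring.
Qed.

(** Squared Frobenius distance from the unnormalized Gram matrix of the observed scores to [n] times
    the identity. Its mean is linear in [n], against the threshold [n ^+ 2] used below. *)
Definition gramdev n w : R :=
  \sum_(k < K) \sum_(l < K) (\sum_(i < n) z k (X i w) * z l (X i w) - (n * (k == l))%:R) ^+ 2.

Definition gramdev1 : R :=
  \sum_(k < K) \sum_(l < K) \int[Q]_x ((z k x * z l x - (k == l)%:R) ^+ 2).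

Lemma bounded_gramdev n : bounded_mfun (gramdev n).
Proof.
apply: bounded_mfun_sum => k; apply: bounded_mfun_sum => l; apply: bounded_mfunX.
apply: bounded_mfunB; last exact: bounded_mfun_cst.
by apply: bounded_mfun_sum => i; apply: bounded_mfunM; exact: bounded_mfun_comp.
Qed.

Lemma mean_gramdev n : \int[P]_w gramdev n w = n%:R * gramdev1.
Proof.
have be k l : bounded_mfun (fun x => z k x * z l x - (k == l)%:R).
  by apply: bounded_mfunB; [exact: bounded_mfunM|exact: bounded_mfun_cst].
have E k l w : \sum_(i < n) z k (X i w) * z l (X i w) - (n * (k == l))%:R =
    psum X (fun x => z k x * z l x - (k == l)%:R) n w.
  by rewrite /psum sumrB sumr_const card_ord natrM mulr_natl.
have bE k l : bounded_mfun (fun w => (\sum_(i < n) z k (X i w) * z l (X i w) -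
    (n * (k == l))%:R) ^+ 2).
  under eq_fun do rewrite E; apply: bounded_mfunX; exact: bounded_mfun_psum.
rewrite mean_sum; last by move=> k; exact: bounded_mfun_sum.
rewrite /gramdev1 mulr_sumr; apply: eq_bigr => k _.
rewrite mean_sum// mulr_sumr; apply: eq_bigr => l _.
under eq_Rintegral do rewrite E; rewrite (mean_psum_sqr indX XQ)//.
rewrite meanB ?mean_cst ?zz ?subrr//; first exact: bounded_mfunM.
exact: bounded_mfun_cst.
Qed.

End moments.

(** * A deterministic lower bound for the log-likelihood *)

(** From [ln (1 + y) <= y] at [y = - u / (1 + u)] one gets [u / (1 + u) <= ln (1 + u)]. Comparing
    with [u - 2 u^2] leaves [u^2 (1 + 2u) >= 0], which is where [u >= -1/2] enters. *)
Lemma ln1D_ge (R : realType) (u : R) : `|u| <= 2^-1 -> u - 2%:R * u ^+ 2 <= ln (1 + u).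
Proof.
rewrite ler_norml => /andP[u1 u2].
have u0 : 0 < 1 + u by lra.
have -> : ln (1 + u) = - ln (1 + - (u / (1 + u))).
  have -> : 1 + - (u / (1 + u)) = (1 + u)^-1 by field; rewrite gt_eqF.
  by rewrite lnV ?opprK// posrE.
have y1 : -1 < - (u / (1 + u)) by rewrite ltrN2 ltr_pdivrMr// mul1r; lra.
have := le_ln1Dx y1; rewrite -lerN2; apply: le_trans.
rewrite opprK ler_pdivlMr//.
have : 0 <= u ^+ 2 * (1 + 2%:R * u) by apply: mulr_ge0; [exact: sqr_ge0|lra].
by rewrite expr2; nra.
Qed.

(** The operator norm is at most the Frobenius norm. *)
Lemma quadratic_form_le (R : realType) (K : nat) (n : R) (s : 'I_K -> R)
    (D : 'I_K -> 'I_K -> R) : 0 < n ->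
  \sum_k \sum_l D k l ^+ 2 <= n ^+ 2 ->
  \sum_k \sum_l s k * s l * D k l <= n * \sum_k s k ^+ 2.
Proof.
move=> n0 Dn; set A := \sum_k s k ^+ 2.
have [A0|A0] := eqVneq A 0.
  have s0 k : s k = 0.
    apply/eqP; rewrite -sqrf_eq0; move/eqP: A0.
    rewrite psumr_eq0 => [/allP/(_ k)|i _]; last exact: sqr_ge0.
    by rewrite mem_index_enum => /(_ isT).
  by rewrite A0 mulr0 big1// => k _; rewrite big1// => l _; rewrite s0 !mul0r.
have {}A0 : 0 < A by rewrite lt_def A0 sumr_ge0// => k _; exact: sqr_ge0.
(* Young's inequality with weights chosen so that each of the two summed terms is at most
   [n * A / 2]. The weights divide by [A], hence the separate case [A = 0]. *)
have H k l : s k * s l * D k l <=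
    (n / (2%:R * A)) * (s k ^+ 2 * s l ^+ 2) + (A / (2%:R * n)) * D k l ^+ 2.
  have : 0 <= (n * (s k * s l) - A * D k l) ^+ 2 / (2%:R * n * A).
    by rewrite divr_ge0 ?sqr_ge0// !mulr_ge0// ltW.
  move=> H; rewrite -subr_ge0; move: H.
  suff -> : (n * (s k * s l) - A * D k l) ^+ 2 / (2%:R * n * A) =
    n / (2%:R * A) * (s k ^+ 2 * s l ^+ 2) + A / (2%:R * n) * D k l ^+ 2 - s k * s l * D k l by [].
  by field; rewrite !gt_eqF.
apply: (@le_trans _ _ (\sum_k \sum_l ((n / (2%:R * A)) * (s k ^+ 2 * s l ^+ 2) +
    (A / (2%:R * n)) * D k l ^+ 2))).
  by apply: ler_sum => k _; apply: ler_sum => l _.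
under eq_bigr do rewrite big_split -!mulr_sumr/=.
rewrite big_split -!mulr_sumr -mulr_suml/= -/A.
have : (A / (2%:R * n)) * (\sum_k \sum_l D k l ^+ 2) <= (A / (2%:R * n)) * n ^+ 2.
  by rewrite ler_wpM2l// divr_ge0// ?mulr_ge0// ltW.
have -> : A / (2%:R * n) * n ^+ 2 = n * A / 2%:R by field; rewrite gt_eqF.
have -> : n / (2%:R * A) * (A * A) = n * A / 2%:R by field; rewrite gt_eqF.
lra.
Qed.

(** With coefficients [c * s k / n] and a Gram matrix bounded by [2n] times the identity, [ln1D_ge]
    leaves at least [(c - 4 c^2) |s|^2 / n]. The maximizer [c = 1/8] gives the factor [1/16], and
    [|s|^2 >= nK/2] turns it into [K/32]. *)
Lemma sum_ln_ge (R : realType) (n K : nat) (z : 'I_n -> 'I_K -> R) :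
  let s k := \sum_i z i k in
  let u i := \sum_k s k / (8 * n%:R) * z i k in
  (0 < n)%N ->
  \sum_k \sum_l (\sum_i z i k * z i l - (n * (k == l))%:R) ^+ 2 <= n%:R ^+ 2 ->
  (n * K)%:R / 2%:R <= \sum_k s k ^+ 2 ->
  (forall i, `|u i| <= 2^-1) ->
  K%:R / 32%:R <= \sum_i ln (1 + u i).
Proof.
move=> s u n0 Dn sK u1.
have n0' : 0 < n%:R :> R by rewrite ltr0n.
pose A := \sum_k s k ^+ 2.
apply: (@le_trans _ _ (\sum_i (u i - 2%:R * u i ^+ 2))); last first.
  by apply: ler_sum => i _; exact: ln1D_ge.
rewrite sumrB -mulr_sumr.
have -> : \sum_i u i = A / (8 * n%:R).
  rewrite /u exchange_big/= /A mulr_suml; apply: eq_bigr => k _.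
  by rewrite -mulr_sumr -/(s k) expr2 mulrAC.
(* The Gram matrix is split into [n] times the identity, which contributes [n * A], and its
   deviation, which [quadratic_form_le] bounds by the same amount. *)
have -> : \sum_i u i ^+ 2 = (64%:R * n%:R ^+ 2)^-1 *
    (\sum_k \sum_l s k * s l * (\sum_i z i k * z i l - (n * (k == l))%:R) +
     n%:R * A).
  transitivity ((64%:R * n%:R ^+ 2)^-1 *
      (\sum_k \sum_l s k * s l * (\sum_i z i k * z i l))).
    under eq_bigr => i _.
      rewrite expr2 /u mulr_suml.
      under eq_bigr do rewrite mulr_sumr.
      over.
    rewrite exchange_big/= mulr_sumr; apply: eq_bigr => k _.
    rewrite exchange_big/= mulr_sumr; apply: eq_bigr => l _.
    rewrite [s k * s l * _]mulr_sumr mulr_sumr; apply: eq_bigr => i _.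
    by field; rewrite gt_eqF.
  congr (_ * _); rewrite [n%:R * _]mulr_sumr -big_split/=; apply: eq_bigr => k _.
  have -> : n%:R * s k ^+ 2 = \sum_l s k * s l * (n * (k == l))%:R.
    rewrite (bigD1 k)//= eqxx muln1 big1 ?addr0 => [|l lk].
      by rewrite mulrC expr2.
    by rewrite eq_sym (negbTE lk) muln0 mulr0.
  by rewrite -big_split/=; apply: eq_bigr => l _; ring.
have := quadratic_form_le s n0' Dn; rewrite -/A => Q.
set q := \sum_k _ in Q *.
have : 2%:R * ((64%:R * n%:R ^+ 2)^-1 * (q + n%:R * A)) <= A / (16%:R * n%:R).
  have -> : A / (16%:R * n%:R) = 2%:R * ((64%:R * n%:R ^+ 2)^-1 * (n%:R * A + n%:R * A)).
    by field; rewrite gt_eqF.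
  rewrite ler_wpM2l// ler_wpM2l ?lerD2r// invr_ge0 mulr_ge0// sqr_ge0//.
have : K%:R / 32%:R <= A / (16%:R * n%:R).
  rewrite ler_pdivlMr ?mulr_gt0//.
  have -> : K%:R / 32%:R * (16%:R * n%:R) = (n * K)%:R / 2%:R :> R.
    by rewrite natrM; field.
  exact: sK.
have -> : A / (8 * n%:R) = A / (16%:R * n%:R) + A / (16%:R * n%:R).
  by field; rewrite gt_eqF.
lra.
Qed.

(** * Densities and reweighting *)

Section density.
Local Open Scope ereal_scope.
Context d (T : measurableType d) (R : realType).

Import HBNNSimple.

(** The argument runs through simple functions and monotone convergence, so that it holds for a [mu]
    that is not sigma-finite. It serves both for [Q] against [mu] and for a reweighted law against
    [g0]. *)
Lemma ge0_integral_density (mu nu : {measure set T -> \bar R}) (f : T -> R)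
    (a : T -> \bar R) :
  measurable_fun setT f -> (forall x, (0 <= f x)%R) ->
  (forall A, measurable A -> nu A = \int[mu]_(x in A) (f x)%:E) ->
  measurable_fun setT a -> (forall x, 0 <= a x) ->
  \int[nu]_x a x = \int[mu]_x (a x * (f x)%:E).
Proof.
move=> mf f0 nuE ma a0.
pose h := nnsfun_approx measurableT ma.
have mfE : measurable_fun setT (EFin \o f) by exact/measurable_EFinP.
have -> : \int[nu]_x a x = lim (\int[nu]_x (EFin \o h n) x @[n --> \oo]).
  have aE x : a x = lim ((EFin \o h n) x @[n --> \oo]).
    by apply/esym/cvg_lim => //; exact: cvg_nnsfun_approx.
  under eq_integral do rewrite aE.
  apply: monotone_convergence => //.
  - by move=> n; exact/measurable_EFinP.
  - by move=> n x _ /=; rewrite lee_fin.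
  - by move=> x _ m n mn; rewrite lee_fin; exact/lefP/nd_nnsfun_approx.
have -> : \int[mu]_x (a x * (f x)%:E) =
    lim (\int[mu]_x ((EFin \o h n) x * (f x)%:E) @[n --> \oo]).
  have aE x : a x * (f x)%:E = lim ((EFin \o h n) x * (f x)%:E @[n --> \oo]).
    by apply/esym/cvg_lim => //; apply: cvgeZr => //; exact: cvg_nnsfun_approx.
  under eq_integral do rewrite aE.
  apply: monotone_convergence => //.
  - by move=> n; apply: emeasurable_funM => //; exact/measurable_EFinP.
  - by move=> n x _ /=; rewrite mule_ge0// lee_fin.
  - move=> x _ m n mn; rewrite lee_wpmul2r ?lee_fin//.
    exact/lefP/nd_nnsfun_approx.
congr (lim (_ @ \oo)); apply/funext => n.
transitivity (\int[nu]_x (\sum_(y \in range (h n)) (y * \1_(h n @^-1` [set y]) x)%:E)).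
  by apply: eq_integral => t _; rewrite /= fimfunE -fsumEFin.
rewrite ge0_integral_fsum//; last 2 first.
- by move=> y; apply/measurable_EFinP; exact: measurable_funM.
- by move=> y x _; exact: nnfun_muleindic_ge0.
transitivity (\int[mu]_x (\sum_(y \in range (h n))
    ((y * \1_(h n @^-1` [set y]) x)%:E * (f x)%:E))); last first.
  apply: eq_integral => x _.
  rewrite -ge0_mule_fsuml => [|y]; last exact: nnfun_muleindic_ge0.
  by rewrite fsumEFin// -(fimfunE _ x).
rewrite ge0_integral_fsum//; last 2 first.
- move=> y; apply: emeasurable_funM => //.
  by apply/measurable_EFinP; exact: measurable_funM.
- by move=> y x _; apply: mule_ge0; [exact: nnfun_muleindic_ge0|rewrite lee_fin].
apply: eq_fsbigr => r /[1!inE] -[t _ <-].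
under eq_integral do rewrite EFinM.
rewrite integralZl_indic_nnsfun//.
under [RHS]eq_integral do rewrite EFinM -muleA.
rewrite ge0_integralZl//; last 3 first.
- by apply: emeasurable_funM => //; exact/measurable_EFinP.
- by move=> x _; rewrite mule_ge0 ?lee_fin.
- by rewrite lee_fin.
congr (_ * _); rewrite integral_indic// setIT nuE//.
rewrite [LHS]integral_mkcond; apply: eq_integral => x _.
by rewrite epatch_indic muleC.
Qed.

(** A nonnegative integral is a supremum over simple functions below the integrand, and each of
    these vanishes off [N]. This covers the integrand of [chi], whose measurability is never
    established. *)
Lemma ge0_integral_null (mu : {measure set T -> \bar R}) (N : set T)
    (h : T -> \bar R) : measurable N -> mu N = 0 -> (forall x, 0 <= h x) ->
  (forall x, ~ N x -> h x = 0) -> \int[mu]_x h x = 0.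
Proof.
move=> mN N0 h0 hN; apply/eqP; rewrite eq_le integral_ge0// andbT.
rewrite ge0_integralTE//; apply: ge_ereal_sup => _ [g gh <-].
rewrite -integralT_nnsfun (@ge0_ae_eq_integral _ _ _ _ _ _ (cst 0))//=.
- by rewrite integral0.
- exact/measurable_EFinP.
- by move=> x _; rewrite lee_fin.
exists N; split => // x /= H; apply: contrapT => /hN hx; apply: H => _.
have := gh x; rewrite hx => gx.
by apply/eqP; rewrite eq_le [X in X && _]gx/= lee_fin.
Qed.

Lemma reweighted_probability (g0 : probability T R) (w : T -> R) :
  bounded_mfun w -> (forall t, (0 <= w t)%R) -> (\int[g0]_t w t = 1)%R ->
  exists g : probability T R,
    forall A, measurable A -> g A = \int[g0]_(t in A) (w t)%:E.
Proof.
move=> bw w0 w1; pose nu A := \int[g0]_(t in A) (w t)%:E.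
have nu0 : nu set0 = 0 by rewrite /nu integral_set0.
have nu_ge0 A : 0 <= nu A by apply: integral_ge0 => t _; rewrite lee_fin.
have nu_sa : semi_sigma_additive nu.
  apply: semi_sigma_additive_nng_induced; first by apply/measurable_EFinP; exact: bw.1.
  by move=> t; rewrite lee_fin.
have nu1 : nu setT = 1.
  by rewrite /nu -w1 /Rintegral fineK//; exact: fin_num_integral_bounded.
pose m : {measure set T -> \bar R} := HB.pack nu
  (isMeasure.Build _ _ _ nu nu0 nu_ge0 nu_sa).
pose g : probability T R := HB.pack nu (Measure.class m)
  (Measure_isProbability.Build _ _ _ m nu1).
by exists g.
Qed.

End density.

(** * Posterior means *)

Section posterior.
Context (R : realType) (d1 d2 : measure_display).
Context (T : measurableType d1) (S : measurableType d2).
Variables (mu : {measure set S -> \bar R}) (p : T -> S -> R).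
Variables (g0 : probability T R) (Q : probability S R).
Hypothesis p_ge0 : forall t x, 0 <= p t x.
Hypothesis mp : measurable_fun setT (fun xt : S * T => p xt.2 xt.1).
Hypothesis p1 : forall t, (\int[mu]_x (p t x)%:E = 1)%E.
Hypothesis QE : forall A, measurable A ->
  (Q A = \int[mu]_(x in A) mixture p g0 x)%E.

Local Notation f0 := (mixture p g0).

(* Equal to [0] where [f0 x] is [0] or [+oo]. *)
Definition posterior_mean (phi : T -> R) (x : S) : R :=
  fine (\int[g0]_t (phi t * p t x)%:E)%E / fine (f0 x).

Lemma mixture_ge0 (g : probability T R) x : (0 <= mixture p g x)%E.
Proof. by apply: integral_ge0 => t _; rewrite lee_fin. Qed.

Lemma measurable_mixture (g : probability T R) :
  measurable_fun setT (mixture p g).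
Proof.
apply: (@measurable_fun_fubini_tonelli_F _ _ _ _ _ g
  (fun xt => (p xt.2 xt.1)%:E)).
  exact/measurable_EFinP.
by move=> xt; rewrite lee_fin.
Qed.

Lemma measurable_density_param x : measurable_fun setT (p ^~ x).
Proof. exact: (measurable_fun_pair2 x mp). Qed.

Lemma measurable_density_obs t : measurable_fun setT (p t).
Proof. exact: (measurable_fun_pair1 t mp). Qed.

Lemma mixture_fineK x : 0 < fine (f0 x) -> (fine (f0 x))%:E = f0 x.
Proof.
have := mixture_ge0 g0 x; case: (f0 x) => //=.
by rewrite ltxx.
Qed.

Lemma integrable_bounded_density phi x : bounded_mfun phi ->
  0 < fine (f0 x) -> g0.-integrable setT (fun t => (phi t * p t x)%:E).
Proof.
move=> [mphi [B phiB]] fx.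
apply: (@le_integrable _ _ _ _ _ _ _ (fun t => (B%:E * (p t x)%:E)%E)) => //.
- apply/measurable_EFinP; apply: measurable_funM => //.
  exact: measurable_density_param.
- move=> t _; rewrite -EFinM !abse_EFin lee_fin !normrM (ger0_norm (p_ge0 t x)).
  by rewrite ler_wpM2r// (le_trans (phiB t))// ler_norm.
apply: integrableZl => //; apply/integrableP; split.
  by apply/measurable_EFinP; exact: measurable_density_param.
rewrite (eq_integral (fun t => (p t x)%:E)) => [|t _].
  by rewrite -/(mixture p g0 x) -mixture_fineK// ltry.
by rewrite /= ger0_norm.
Qed.

Lemma integral_posterior_mean phi x : bounded_mfun phi ->
  0 < fine (f0 x) ->
  (\int[g0]_t (phi t * p t x)%:E)%E = (posterior_mean phi x * fine (f0 x))%:E.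
Proof.
move=> bphi fx; rewrite /posterior_mean divfK ?gt_eqF// fineK//.
by apply: integrable_fin_num => //; exact: integrable_bounded_density.
Qed.

Lemma posterior_mean_improper phi x : fine (f0 x) <= 0 -> posterior_mean phi x = 0.
Proof.
move=> fx; rewrite /posterior_mean (_ : fine (f0 x) = 0) ?invr0 ?mulr0//.
by apply/eqP; rewrite eq_le fx fine_ge0// mixture_ge0.
Qed.

Lemma posterior_meanDZ c phi psi x : bounded_mfun phi -> bounded_mfun psi ->
  posterior_mean (fun t => phi t + c * psi t) x =
  posterior_mean phi x + c * posterior_mean psi x.
Proof.
move=> bphi bpsi; have [fx|fx] := ltP 0 (fine (f0 x)); last first.
  by rewrite !posterior_mean_improper// mulr0 addr0.
have bcpsi := bounded_mfunZ c bpsi.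
have fx0 : fine (f0 x) != 0 by rewrite gt_eqF.
apply: (mulIf fx0); apply: EFin_inj.
have bsum := bounded_mfunD bphi bcpsi.
rewrite mulrDl -(mulrA c) EFinD [in RHS](EFinM c) -!integral_posterior_mean//.
have iphi := integrable_bounded_density bphi fx.
have ipsi := integrable_bounded_density bpsi fx.
rewrite -integralZl// -integralD//; last exact: integrableZl.
by apply: eq_integral => t _; rewrite -EFinM -EFinD mulrDl mulrA.
Qed.

Lemma posterior_mean_ge0 phi x : (forall t, 0 <= phi t) -> 0 <= posterior_mean phi x.
Proof.
move=> phi0; apply: divr_ge0; apply: fine_ge0; last exact: mixture_ge0.
by apply: integral_ge0 => t _; rewrite lee_fin mulr_ge0.
Qed.

(** The indicator reflects the default value [0] at improper points; it is [1] almost surely under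
    [Q], by [law_improper]. *)
Lemma posterior_mean_cst c x :
  posterior_mean (fun=> c) x = c * (0 < fine (f0 x))%R%:R.
Proof.
have [fx|fx] := ltP 0 (fine (f0 x)); last first.
  by rewrite posterior_mean_improper// mulr0.
have fx0 : fine (f0 x) != 0 by rewrite gt_eqF.
rewrite mulr1; apply: (mulIf fx0); apply: EFin_inj.
have bc := bounded_mfun_cst T; rewrite -integral_posterior_mean//.
rewrite EFinM mixture_fineK// -integralZl//.
have := integrable_bounded_density (bc R 1) fx.
by apply: eq_integrable => // t _; rewrite mul1r.
Qed.

(** Positivity applied to [B + phi] and [B - phi]. *)
Lemma posterior_mean_le phi B x : bounded_mfun phi ->
  (forall t, `|phi t| <= B) -> `|posterior_mean phi x| <= B.
Proof.
move=> bphi phiB; have bc := bounded_mfun_cst T B.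
have B0 : 0 <= B by exact: le_trans (phiB point).
have c1 : B * (0 < fine (f0 x))%R%:R <= B by case: (_ < _); rewrite ?mulr1// mulr0.
have h1 : 0 <= posterior_mean (fun t => B + 1 * phi t) x.
  by apply: posterior_mean_ge0 => t; have := phiB t; rewrite ler_norml mul1r; lra.
have h2 : 0 <= posterior_mean (fun t => B + (-1) * phi t) x.
  by apply: posterior_mean_ge0 => t; have := phiB t; rewrite ler_norml mulN1r; lra.
move: h1 h2; rewrite !posterior_meanDZ// posterior_mean_cst.
by rewrite ler_norml; lra.
Qed.

Lemma measurable_fine_mixture : measurable_fun setT (fun x => fine (f0 x)).
Proof.
apply: measurableT_comp; first exact: fine_measurable.
exact: measurable_mixture.
Qed.

Lemma measurable_fine_mixtureV : measurable_fun setT (fun x => (fine (f0 x))^-1).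
Proof.
rewrite (_ : (fun x => _) = (fun x => fine (f0 x) `^ (-1))); last first.
  by apply/funext => x; rewrite powR_inv1// fine_ge0// mixture_ge0.
exact: (measurableT_comp (measurable_powR (-1)) measurable_fine_mixture).
Qed.

Lemma bounded_posterior_mean phi : bounded_mfun phi ->
  bounded_mfun (posterior_mean phi).
Proof.
move=> bphi; split; last first.
  by have [_ [B phiB]] := bphi; exists B => x; exact: posterior_mean_le.
apply: measurable_funM.
  apply: measurableT_comp; first exact: fine_measurable.
  (* [phi] may change sign and joint integrability is not at hand, so Tonelli is applied to the
     positive and negative parts separately. *)
  under eq_fun do rewrite integralE.
  pose F (xt : S * T) := (phi xt.2 * p xt.2 xt.1)%:E.
  have mF : measurable_fun setT F.
    apply/measurable_EFinP; apply: measurable_funM => //.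
    exact: (measurableT_comp bphi.1 (@measurable_snd _ _ S T)).
  apply: emeasurable_funB.
    rewrite (_ : (fun x => _) = fubini_F g0 (F^\+)%E).
      by apply: measurable_fun_fubini_tonelli_F => //; exact: measurable_funepos.
    apply/funext => x; apply: eq_integral => t _.
    by rewrite -[X in (X^\+)%E]/(F \o pair x) funepos_comp.
  rewrite (_ : (fun x => _) = fubini_F g0 (F^\-)%E).
    by apply: measurable_fun_fubini_tonelli_F => //; exact: measurable_funeneg.
  apply/funext => x; apply: eq_integral => t _.
  by rewrite -[X in (X^\-)%E]/(F \o pair x) funeneg_comp.
exact: measurable_fine_mixtureV.
Qed.

Lemma measurable_mixture_infinite : measurable [set x | f0 x = +oo%E].
Proof.
rewrite -[X in measurable X]setTI -[X in _ `&` X]/(f0 @^-1` [set +oo%E]).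
by apply: measurable_mixture => //; exact: emeasurable_set1.
Qed.

Lemma mixture_infinite_null : mu [set x | f0 x = +oo%E] = 0%E.
Proof.
have : mu.-integrable setT f0.
  apply/integrableP; split; first exact: measurable_mixture.
  under eq_integral do rewrite gee0_abs ?mixture_ge0//.
  by rewrite -QE// [X in (X < _)%E](@probability_setT _ _ _ Q) ltry.
move=> /(integrable_ae measurableT) [N [mN N0 sub]].
have mA := measurable_mixture_infinite.
apply/eqP; rewrite -measure_le0 -N0; apply: le_measure; rewrite ?inE//.
by move=> x /= fx; apply: sub => /= /(_ I); rewrite fx.
Qed.

(** [ge0_integral_density] takes a real-valued density; replacing [+oo] by [0] changes [f0] on a
    [mu]-null set only. *)
Lemma law_fine_mixture A : measurable A ->
  (Q A = \int[mu]_(x in A) (fine (f0 x))%:E)%E.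
Proof.
move=> mA; rewrite QE//; apply: ge0_ae_eq_integral => //.
- by apply: measurable_funTS; exact: measurable_mixture.
- by apply/measurable_EFinP; apply: measurable_funTS; exact: measurable_fine_mixture.
- by move=> x _; exact: mixture_ge0.
- by move=> x _; rewrite lee_fin fine_ge0// mixture_ge0.
exists [set x | f0 x = +oo%E]; split.
- exact: measurable_mixture_infinite.
- exact: mixture_infinite_null.
move=> x /= H; apply: contrapT => fx; apply: H => _.
have := mixture_ge0 g0 x; move: fx; case: (f0 x) => //.
Qed.

Lemma measurable_improper : measurable [set x | ~ 0 < fine (f0 x)].
Proof.
rewrite (_ : [set x | _] = (fun x => fine (f0 x)) @^-1` `]-oo, 0]).
  by rewrite -[X in measurable X]setTI; exact: measurable_fine_mixture.
by apply/seteqP; split => x /=; rewrite in_itv/= leNgt => /negP.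
Qed.

Lemma law_improper : Q [set x | ~ 0 < fine (f0 x)] = 0%E.
Proof.
rewrite (law_fine_mixture measurable_improper) (eq_integral (cst 0%E)) ?integral0// => x.
rewrite inE/= => /negP; rewrite -leNgt => fx.
by congr EFin; apply/eqP; rewrite eq_le fx fine_ge0// mixture_ge0.
Qed.

(* [p t x / f0 x] integrates to at most [1] under the law of the observations,
   so Tonelli yields this inequality; applied to [B + phi] and [B - phi] it
   becomes an equality, without a Fubini theorem for [mu], which need not be
   sigma-finite. *)
Lemma mean_posterior_mean_le phi : bounded_mfun phi -> (forall t, 0 <= phi t) ->
  \int[Q]_x posterior_mean phi x <= \int[g0]_t phi t.
Proof.
move=> bphi phi0; have bpm := bounded_posterior_mean bphi.
rewrite -lee_fin /Rintegral !fineK ?fin_num_integral_bounded//.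
pose r t x := p t x / fine (f0 x).
have r0 t x : 0 <= r t x by rewrite divr_ge0// fine_ge0// mixture_ge0.
have mr : measurable_fun setT (fun xt : S * T => r xt.2 xt.1).
  apply: measurable_funM => //.
  exact: (measurableT_comp measurable_fine_mixtureV (@measurable_fst _ _ S T)).
have kappa t : (\int[Q]_x (r t x)%:E <= 1)%E.
  have mrt : measurable_fun setT (EFin \o r t).
    by apply/measurable_EFinP; exact: (measurable_fun_pair1 t mr).
  have F0 x : 0 <= fine (f0 x) by rewrite fine_ge0// mixture_ge0.
  have rt0 x : (0 <= (EFin \o r t) x)%E by rewrite lee_fin.
  rewrite (ge0_integral_density measurable_fine_mixture F0 law_fine_mixture mrt rt0).
  rewrite -(p1 t); apply: ge0_le_integral => //.
  - by move=> x _; rewrite mule_ge0 ?lee_fin.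
  - by apply: emeasurable_funM => //; apply/measurable_EFinP; exact: measurable_fine_mixture.
  - by apply/measurable_EFinP; exact: measurable_density_obs.
  - move=> x _; rewrite -EFinM lee_fin /r; have [->|fx] := eqVneq (fine (f0 x)) 0.
      by rewrite mulr0.
    by rewrite divfK.
have E x : (posterior_mean phi x)%:E = (\int[g0]_t (phi t * r t x)%:E)%E.
  have [fx|fx] := ltP 0 (fine (f0 x)); last first.
    rewrite posterior_mean_improper//; symmetry; apply: integral0_eq => t _.
    rewrite /r (_ : fine (f0 x) = 0) ?invr0 ?mulr0//.
    by apply/eqP; rewrite eq_le fx fine_ge0// mixture_ge0.
  have fx0 : fine (f0 x) != 0 by rewrite gt_eqF.
  under eq_integral do rewrite mulrA EFinM.
  rewrite integralZr//; last exact: integrable_bounded_density.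
  by rewrite integral_posterior_mean// -EFinM mulfK.
under eq_integral do rewrite E.
pose h (xt : S * T) := (phi xt.2 * r xt.2 xt.1)%:E.
have mh : measurable_fun setT h.
  apply/measurable_EFinP; apply: measurable_funM => //.
  exact: (measurableT_comp bphi.1 (@measurable_snd _ _ S T)).
have h0 xt : (0 <= h xt)%E by rewrite lee_fin mulr_ge0.
rewrite (fubini_tonelli (m1 := Q) (m2 := g0) h mh h0).
apply: ge0_le_integral => //.
- by move=> t _; exact: integral_ge0.
- exact: measurable_fun_fubini_tonelli_G.
- by apply/measurable_EFinP; exact: bphi.1.
move=> t _; rewrite /h/=; under eq_integral do rewrite EFinM.
rewrite ge0_integralZl//.
- by rewrite -[leRHS]mule1 lee_wpmul2l// lee_fin.
- by apply/measurable_EFinP; exact: (measurable_fun_pair1 t mr).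
- by move=> x _; rewrite lee_fin.
- by rewrite lee_fin.
Qed.

Lemma mean_proper : \int[Q]_x (0 < fine (f0 x))%R%:R = 1.
Proof.
have bp : bounded_mfun (fun x => (0 < fine (f0 x))%R%:R : R).
  have := bounded_posterior_mean (bounded_mfun_cst T 1).
  rewrite (_ : posterior_mean _ = (fun x => (0 < fine (f0 x))%R%:R))//.
  by apply/funext => x; rewrite posterior_mean_cst mul1r.
have b1 := bounded_mfun_cst S (1 : R).
apply/eqP; rewrite -subr_eq0 -{2}(mean_cst Q 1) -meanB//; apply/eqP.
apply: (mean_ae_eq0 _ measurable_improper law_improper); first exact: bounded_mfunB.
by move=> x /contrapT ->; rewrite subrr.
Qed.

Lemma mean_posterior_mean phi : bounded_mfun phi ->
  \int[Q]_x posterior_mean phi x = \int[g0]_t phi t.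
Proof.
move=> bphi; have [_ [B phiB]] := bphi; have bB := bounded_mfun_cst T B.
have bpm := bounded_posterior_mean bphi.
(* [c] stands for the two signs; adding [B] makes [c * phi] nonnegative. *)
have H c : c ^+ 2 = 1 -> B + c * \int[Q]_x posterior_mean phi x <=
    B + c * \int[g0]_t phi t.
  move=> c2; have bc := bounded_mfunZ c bphi; have bpc := bounded_mfunZ c bpm.
  have := @mean_posterior_mean_le (fun t => B + c * phi t) (bounded_mfunD bB bc).
  rewrite meanD// mean_cst meanZ//.
  under eq_Rintegral do rewrite posterior_meanDZ// posterior_mean_cst.
  have bp := bounded_posterior_mean bB.
  have {}bp : bounded_mfun (fun x => B * (0 < fine (f0 x))%R%:R).
    rewrite (_ : (fun x => _) = posterior_mean (fun=> B))//.
    by apply/funext => x; rewrite posterior_mean_cst.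
  have b1 : bounded_mfun (fun x => (0 < fine (f0 x))%R%:R : R).
    have := bounded_posterior_mean (bounded_mfun_cst T 1).
    rewrite (_ : posterior_mean _ = (fun x => (0 < fine (f0 x))%R%:R))//.
    by apply/funext => x; rewrite posterior_mean_cst mul1r.
  rewrite meanD// !meanZ// mean_proper mulr1; apply => t.
  have c1 : `|c| = 1 by apply/eqP; rewrite -sqrp_eq1// -normrX c2 normr1.
  have : `|c * phi t| <= B by rewrite normrM c1 mul1r.
  by rewrite ler_norml; lra.
have := H 1 (expr1n _ _); have := H (-1) (etrans (sqrrN 1) (expr1n _ _)).
lra.
Qed.

End posterior.

(** * Reweighted mixing laws and identifiability *)

Section reweighting.
Context (R : realType) (d1 d2 : measure_display).
Context (T : measurableType d1) (S : measurableType d2).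
Variables (mu : {measure set S -> \bar R}) (p : T -> S -> R).
Variables (g0 : probability T R) (Q : probability S R).
Hypothesis p_ge0 : forall t x, 0 <= p t x.
Hypothesis mp : measurable_fun setT (fun xt : S * T => p xt.2 xt.1).
Hypothesis p1 : forall t, (\int[mu]_x (p t x)%:E = 1)%E.
Hypothesis QE : forall A, measurable A ->
  (Q A = \int[mu]_(x in A) mixture p g0 x)%E.

Local Notation f0 := (mixture p g0).
Local Notation Z := (posterior_mean p g0).

Lemma mixture_reweighted (phi : T -> R) (g : probability T R) x :
  bounded_mfun phi -> (forall t, 0 <= 1 + phi t) ->
  (forall A, measurable A -> (g A = \int[g0]_(t in A) (1 + phi t)%:E)%E) ->
  0 < fine (f0 x) -> mixture p g x = (fine (f0 x) * (1 + Z phi x))%:E.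
Proof.
move=> bphi phi1 gE fx.
have b1 := bounded_mfun_cst T (1 : R); have b1phi := bounded_mfunD b1 (bounded_mfunZ 1 bphi).
have mpx : measurable_fun setT (fun t => (p t x)%:E).
  by apply/measurable_EFinP; exact: measurable_density_param.
have px0 t : (0 <= (p t x)%:E)%E by rewrite lee_fin.
have m1phi : measurable_fun setT (fun t => 1 + phi t).
  exact: (bounded_mfunD b1 bphi).1.
rewrite [LHS](ge0_integral_density m1phi phi1 gE mpx px0).
have -> : 1 + Z phi x = Z (fun t => 1 + 1 * phi t) x.
  by rewrite posterior_meanDZ// posterior_mean_cst// fx mulr1 mul1r.
rewrite mulrC -integral_posterior_mean//.
by apply: eq_integral => t _; rewrite -EFinM mulrC mul1r.
Qed.

Lemma chi_reweighted_eq0 (phi : T -> R) (g : probability T R) :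
  bounded_mfun phi -> (forall t, 0 <= 1 + phi t) ->
  (forall A, measurable A -> (g A = \int[g0]_(t in A) (1 + phi t)%:E)%E) ->
  Q [set x | Z phi x != 0] = 0%E -> chi mu (mixture p g) f0 = 0%E.
Proof.
move=> bphi phi1 gE QZ.
have bZ := bounded_posterior_mean g0 p_ge0 mp bphi.
have mM : measurable [set x | Z phi x != 0].
  rewrite (_ : [set x | _] = Z phi @^-1` (~` [set 0])).
    rewrite -[X in measurable X]setTI; apply: bZ.1 => //.
    exact: measurableC.
  by apply/seteqP; split => x /= /eqP.
(* A [Q]-null set may have positive [mu]-measure. What transfers to [mu] is that [f0] vanishes
   almost everywhere on it, and there the weight [f0] kills the integrand of [chi]. *)
have : ae_eq mu [set x | Z phi x != 0] f0 (cst 0%E).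
  apply/ae_eq_integral_abs => //.
    by apply: measurable_funTS; exact: measurable_mixture.
  rewrite -QZ QE//; apply: eq_integral => x _.
  by rewrite gee0_abs// mixture_ge0.
move=> [N [mN N0 subN]].
rewrite /chi (ge0_integral_null (N := N `|` [set x | f0 x = +oo%E])).
- by rewrite poweR0r// invr_eq0.
- by apply: measurableU => //; exact: measurable_mixture_infinite.
- have mI := measurable_mixture_infinite g0 p_ge0 mp.
  apply/eqP; rewrite -measure_le0; apply: (le_trans (measureU2 _ mN mI)).
  have := mixture_infinite_null p_ge0 mp QE.
  by rewrite /= => ->; rewrite N0 adde0.
- by move=> x; rewrite mule_ge0 ?poweR_ge0 ?mixture_ge0.
move=> x xN; have [fx|fx] := ltP 0 (fine (f0 x)); last first.
  have -> : f0 x = 0%E; last by rewrite mule0.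
  have : f0 x != +oo%E by apply/eqP => fxy; apply: xN; right.
  move: fx (mixture_ge0 p_ge0 g0 x); case: (f0 x) => //= r.
  by rewrite lee_fin => r0 r0' _; congr EFin; apply/eqP; rewrite eq_le r0.
have Z0 : Z phi x = 0.
  apply/eqP; apply: contrapT => /negP Zx; apply: xN; left; apply: subN => /= H.
  by have := H Zx => fx0; rewrite fx0 ltxx in fx.
rewrite (mixture_reweighted bphi phi1 gE fx) Z0 addr0 mulr1.
rewrite -[in X in (X * _)%E](mixture_fineK p_ge0 fx) inver gt_eqF//.
rewrite -EFinM mulfV ?gt_eqF// subee// abse0 poweR0r ?mul0e//.
Qed.

Hypothesis ident : forall g : probability T R,
  chi mu (mixture p g) f0 = 0%E <-> same_law g g0.

(** If the posterior mean of [phi] vanishes, then [(1 + eps phi) dg0] has the same mixture density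
    as [g0] up to null sets. Identifiability makes the two laws equal, so [phi] has integral zero
    over every measurable set. *)
Lemma posterior_mean_inj (phi : T -> R) : bounded_mfun phi ->
  \int[g0]_t phi t = 0 -> \int[Q]_x (Z phi x ^+ 2) = 0 ->
  forall A, measurable A -> \int[g0]_t (phi t * \1_A t) = 0.
Proof.
move=> bphi phi0 Zphi0 A mA.
have [_ [B phiB]] := bphi.
have B0 : 0 <= B by exact: le_trans (phiB point).
(* [B + 1] rather than [B], since the bound may be [0]. *)
pose eps := (B + 1)^-1.
have eps0 : 0 < eps by rewrite invr_gt0; lra.
pose psi t := eps * phi t.
have bpsi : bounded_mfun psi by exact: bounded_mfunZ.
have b1 := bounded_mfun_cst T (1 : R).
have psi1 t : 0 <= 1 + psi t.
  have : `|psi t| <= 1.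
    rewrite normrM gtr0_norm// /eps mulrC ler_pdivrMr ?mul1r; last lra.
    by apply: le_trans (phiB t) _; lra.
  by rewrite ler_norml; lra.
have i1 : \int[g0]_t (1 + psi t) = 1.
  by rewrite meanD// mean_cst meanZ// phi0 mulr0 addr0.
have [g gE] := reweighted_probability (bounded_mfunD b1 bpsi) psi1 i1.
have bZ := bounded_posterior_mean g0 p_ge0 mp bphi.
have QZ : Q [set x | Z psi x != 0] = 0%E.
  rewrite -[RHS](mean_sqr_eq0 bZ Zphi0); congr (Q _); apply/seteqP.
  have E x : Z psi x = eps * Z phi x.
    have b0 := bounded_mfun_cst T (0 : R).
    rewrite -[RHS]add0r -(mul0r (0 < fine (f0 x))%R%:R) -(posterior_mean_cst g0 p_ge0 mp).
    rewrite -posterior_meanDZ//; congr (posterior_mean _ _ _ _).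
    by apply/funext => t; rewrite add0r.
  have epsN := lt0r_neq0 eps0.
  split => x /=; rewrite E; first by apply: contra_neq => ->; rewrite mulr0.
  by move=> Zx; exact: mulf_neq0.
have gg0 := (ident g).1 (chi_reweighted_eq0 bpsi psi1 gE QZ).
have bA := bounded_mfun_indic R mA.
have : fine (g A) = fine (g0 A) by rewrite gg0.
rewrite -[RHS]mean_indic// gE// -/(Rintegral g0 A (fun t => 1 + psi t)) Rintegral_mkcond.
under eq_Rintegral => t _.
  rewrite patch_indic/= mulrDl mul1r -mulrA.
  over.
rewrite meanD//; last exact: (bounded_mfunZ eps (bounded_mfunM bphi bA)).
rewrite meanZ//; last exact: bounded_mfunM.
move/eqP; rewrite -subr_eq0 addrAC subrr add0r mulf_eq0 gt_eqF//= => /eqP.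
exact.
Qed.

End reweighting.

(** * Orthonormal scores *)

Section splitting.
Context (R : realType) (d : measure_display) (T : measurableType d).
Variables (g : probability T R) (E : nat -> set T).
Hypothesis mE : forall i, measurable (E i).
Hypothesis sepE : forall s t, (forall i, E i s <-> E i t) -> s = t.

(** The restriction of [g] to [C] is not carried by finitely many points. Unlike mere positivity of
    [g C], this invariant passes to one piece of a suitable splitting, so splitting can go on
    forever, whether [g] has atoms or not. *)
Definition charges_cofinite (C : set T) : Prop :=
  forall F, finite_set F -> (0 < g (C `\` F))%E.

(** No other point lies on the same side as [t] of every [E i]. *)
Lemma measurable_point (t : T) : measurable [set t].
Proof.
have -> : [set t] = \bigcap_i (if `[< E i t >] then E i else ~` E i).
  apply/seteqP; split => [_ -> i _|s sE]; first by case: asboolP.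
  apply: sepE => i; have := sE i I; case: asboolP => //.
apply: bigcap_measurableType => i _; case: ifP => // _; exact: measurableC.
Qed.

Lemma measurable_finite (F : set T) : finite_set F -> measurable F.
Proof.
move=> finF.
rewrite (_ : F = \bigcup_(t in F) [set t]); last first.
  by apply/seteqP; split => [t Ft|_ [t Ft ->]//]; exists t.
by apply: fin_bigcup_measurable => // t _; exact: measurable_point.
Qed.

Lemma charges_cofiniteT : ~ finitely_discrete g -> charges_cofinite setT.
Proof.
move=> gfd F finF; rewrite lt0e measure_ge0 andbT; apply/eqP => gF.
apply: gfd; exists F => //.
have mF := measurable_finite finF.
move: gF; rewrite setTD => gF; rewrite -[F]setCK.
by rewrite probability_setC ?gF ?sube0//; exact: measurableC.
Qed.

(** If some [E i] cuts [C] into two charged pieces, one of them keeps the invariant: otherwise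
    removing two finite sets would make [C] null. If no [E i] does, each is trivial on [C] up to a
    null set, and [g] on [C] sits on the intersection of the full sides, which has at most one
    point. *)
Lemma charges_cofinite_split C : measurable C -> charges_cofinite C ->
  exists A B, [/\ measurable A, measurable B, A `<=` C /\ B `<=` C,
    A `&` B = set0 & (0 < g A)%E /\ charges_cofinite B].
Proof.
move=> mC cC.
have [[i [Ai Bi]]|nsplit] := pselect (exists i,
    (0 < g (C `&` E i))%E /\ (0 < g (C `\` E i))%E).
  have mA := measurableI _ _ mC (mE i); have mB := measurableD mC (mE i).
  have dAB : (C `&` E i) `&` (C `\` E i) = set0.
    by apply/seteqP; split => // x [[_ ?] [_]].
  have [cB|ncB] := pselect (charges_cofinite (C `\` E i)).
    by exists (C `&` E i), (C `\` E i); split.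
  have [cA|ncA] := pselect (charges_cofinite (C `&` E i)).
    exists (C `\` E i), (C `&` E i); split => //; by rewrite setIC.
  have null B : ~ charges_cofinite B -> exists2 F, finite_set F & (g (B `\` F) <= 0)%E.
    move=> nB; apply: contrapT => H; apply: nB => F finF.
    by rewrite ltNge; apply/negP => ?; apply: H; exists F.
  have [F1 finF1 gF1] := null _ ncA; have [F2 finF2 gF2] := null _ ncB.
  have finF : finite_set (F1 `|` F2) by rewrite finite_setU.
  have := cC _ finF; rewrite ltNge => /negP[].
  have mF1 := measurable_finite finF1; have mF2 := measurable_finite finF2.
  have m1 := measurableD mA mF1; have m2 := measurableD mB mF2.
  apply: (@le_trans _ _ (g ((C `&` E i) `\` F1) + g ((C `\` E i) `\` F2))%E).
    apply: le_trans (measureU2 _ m1 m2); apply: le_measure; rewrite ?inE.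
    - by apply: measurableD => //; exact: measurableU.
    - exact: measurableU.
    - by move=> x [Cx /not_orP[? ?]]; have [Ex|Ex] := pselect (E i x); [left|right].
  by rewrite -[leRHS]adde0 leeD.
pose G i := if `[< g (C `\` E i) = 0%E >] then E i else ~` E i.
have mG i : measurable (G i) by rewrite /G; case: ifP => // _; exact: measurableC.
have gG i : g (C `\` G i) = 0%E.
  rewrite /G; case: asboolP => // /eqP gi; rewrite setDE setCK.
  apply: contrapT => /eqP gi'; apply: nsplit; exists i.
  by rewrite !lt0e gi gi' !measure_ge0.
have fin1 : finite_set (\bigcap_i G i).
  have [[t Gt]|G0] := pselect (exists t, (\bigcap_i G i) t).
    apply: (@sub_finite_set _ _ [set t]) => // s Gs.
    apply: sepE => i; have := Gs i I; have := Gt i I.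
    by rewrite /G; case: asboolP => _ //= ? ?; split.
  apply: (@sub_finite_set _ _ set0) => // s Gs; apply: G0; by exists s.
have := cC _ fin1; rewrite setDE setC_bigcap setI_bigcupr.
suff -> : g (\bigcup_i (C `&` ~` G i)) = 0%E by rewrite ltxx.
apply/eqP; rewrite -measure_le0.
have mCG i : measurable (C `&` ~` G i) by apply: measurableI => //; exact: measurableC.
have mU : measurable (\bigcup_i (C `&` ~` G i)) by exact: bigcupT_measurable.
apply: le_trans (measure_sigma_subadditive _ mCG mU (fun x => id)) _.
by rewrite eseries0// => i _ _; rewrite -setDE; exact: gG.
Qed.

Context (d' : measure_display) (S : measurableType d').
Variables (Q : probability S R) (Z : (T -> R) -> S -> R).
Hypothesis bZ : forall phi, bounded_mfun phi -> bounded_mfun (Z phi).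
Hypothesis ZDZ : forall c phi psi x, bounded_mfun phi -> bounded_mfun psi ->
  Z (fun t => phi t + c * psi t) x = Z phi x + c * Z psi x.
Hypothesis Zinj : forall phi, bounded_mfun phi -> \int[g]_t phi t = 0 ->
  \int[Q]_x (Z phi x ^+ 2) = 0 ->
  forall A, measurable A -> \int[g]_t (phi t * \1_A t) = 0.

Lemma ZB_sum (phi : nat -> T -> R) (psi : T -> R) (e : nat -> R) n x :
  (forall k, bounded_mfun (phi k)) -> bounded_mfun psi ->
  Z (fun t => psi t - \sum_(k < n) e k * phi k t) x =
  Z psi x - \sum_(k < n) e k * Z (phi k) x.
Proof.
move=> bphi bpsi; elim: n => [|n ih].
  by rewrite big_ord0 subr0; congr (Z _ _); apply/funext => t; rewrite big_ord0 subr0.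
transitivity (Z (fun t => (psi t - \sum_(k < n) e k * phi k t) + (- e n) * phi n t) x).
  congr (Z _ _); apply/funext => t; rewrite big_ord_recr/=; ring.
rewrite ZDZ//; last first.
  apply: bounded_mfunB => //; apply: bounded_mfun_sum => k; exact: bounded_mfunZ.
rewrite ih big_ord_recr/=; ring.
Qed.

(* All functions built so far are constant on [C], which still splits into [A]
   and [B]; the next function, the projection of [1_A], takes values on [A] and
   [B] that differ by [1], so it is not [g]-null. *)
Lemma orthonormal_scores K : ~ finitely_discrete g ->
  exists phi : nat -> T -> R,
  [/\ forall k, bounded_mfun (phi k), forall k, \int[g]_t phi k t = 0 &
    forall k l, (k < K)%N -> (l < K)%N ->
      \int[Q]_x (Z (phi k) x * Z (phi l) x) = (k == l)%:R].
Proof.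
move=> gfd.
suff [phi [C [mC [cC [bphi [phi0 [_ zz]]]]]]] : exists (phi : nat -> T -> R) C,
    measurable C /\ charges_cofinite C /\ (forall k, bounded_mfun (phi k)) /\
    (forall k, \int[g]_t phi k t = 0) /\
    (forall k, exists c, forall t, C t -> phi k t = c) /\
    (forall k l, (k < K)%N -> (l < K)%N ->
      \int[Q]_x (Z (phi k) x * Z (phi l) x) = (k == l)%:R) by exists phi.
elim: K => [|K [phi [C [mC [cC [bphi [phi0 [phiC zz]]]]]]]].
  exists (fun _ _ => 0), setT; split=> //; split; first exact: charges_cofiniteT.
  split; first by move=> k; exact: bounded_mfun_cst.
  split; first by move=> k; rewrite mean_cst.
  by split=> // k; exists 0.
have [A [B [mA mB [AC BC] AB [gA cB]]]] := charges_cofinite_split mC cC.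
have gB : (0 < g B)%E by have := cB set0 (finite_set0 T); rewrite setD0.
pose psi t : R := \1_A t - fine (g A).
have bA := bounded_mfun_indic R mA.
have bcA := bounded_mfun_cst T (fine (g A)).
have bpsi : bounded_mfun psi by exact: bounded_mfunB.
have psi0 : \int[g]_t psi t = 0.
  by rewrite meanB// mean_cst mean_indic// subrr.
pose e k := \int[Q]_x (Z psi x * Z (phi k) x).
pose phi' t := psi t - \sum_(k < K) e k * phi k t.
have bsum : bounded_mfun (fun t => \sum_(k < K) e k * phi k t).
  by apply: bounded_mfun_sum => k; exact: bounded_mfunZ.
have bphi' : bounded_mfun phi' by exact: bounded_mfunB.
have phi'0 : \int[g]_t phi' t = 0.
  rewrite meanB// psi0 mean_sum => [|k]; last exact: bounded_mfunZ.
  by rewrite big1 ?subrr// => k _; rewrite meanZ// phi0 mulr0.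
have orth l : (l < K)%N -> \int[Q]_x (Z phi' x * Z (phi l) x) = 0.
  move=> lK; under eq_Rintegral do rewrite ZB_sum// mulrBl mulr_suml.
  have bb k : bounded_mfun (fun x => Z (phi k) x * Z (phi l) x).
    by apply: bounded_mfunM; exact: bZ.
  have bk (k : 'I_K) : bounded_mfun (fun x => e k * Z (phi k) x * Z (phi l) x).
    by under eq_fun do rewrite -mulrA; exact: bounded_mfunZ.
  rewrite meanB; last 2 first.
  - by apply: bounded_mfunM; exact: bZ.
  - exact: bounded_mfun_sum.
  rewrite mean_sum// -/(e l) (bigD1 (Ordinal lK))//= big1 => [|k kl].
    by under eq_Rintegral do rewrite -mulrA; rewrite meanZ// zz// eqxx mulr1 addr0 subrr.
  under eq_Rintegral do rewrite -mulrA; rewrite meanZ// zz//.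
  have /negbTE -> : (k : nat) != l by rewrite -[l]/(val (Ordinal lK)) val_eqE.
  by rewrite mulr0.
pose N := \int[Q]_x (Z phi' x ^+ 2).
have bZ2 : bounded_mfun (fun x => Z phi' x ^+ 2) by apply: bounded_mfunX; exact: bZ.
have N_gt0 : 0 < N.
  rewrite lt_def mean_ge0 ?andbT => [|x]; last exact: sqr_ge0.
  apply/eqP => N0; have inj := Zinj bphi' phi'0 N0.
  have [c cP] := choice phiC.
  pose b := - fine (g A) - \sum_(k < K) e k * c k.
  have phiE t : C t -> phi' t = \1_A t + b.
    move=> Ct; rewrite /phi' /psi /b; under eq_bigr do rewrite cP//.
    by rewrite addrA.
  have valA : (1 + b) * fine (g A) = 0.
    rewrite -mean_indic// -meanZ// -(inj A mA); apply: eq_Rintegral => t _.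
    rewrite indicE; case: (boolP (t \in A)) => [|_]; last by rewrite !mulr0.
    by rewrite inE => At; rewrite phiE ?indicE ?mem_set//; exact: AC.
  have valB : b * fine (g B) = 0.
    have bB := bounded_mfun_indic R mB.
    rewrite -mean_indic// -meanZ// -(inj B mB); apply: eq_Rintegral => t _.
    rewrite [\1_B t]indicE; case: (boolP (t \in B)) => [|_]; last by rewrite !mulr0.
    rewrite inE => Bt; rewrite phiE; last exact: BC.
    rewrite indicE memNset ?add0r// => At.
    by have : (A `&` B) t by []; rewrite AB.
  have pos D : measurable D -> (0 < g D)%E -> fine (g D) != 0.
    by move=> mD gD; rewrite gt_eqF// fine_gt0// gD/= ltey_eq fin_num_measure.
  move/eqP: valB; rewrite mulf_eq0 (negbTE (pos _ mB gB)) orbF => /eqP b0.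
  by move/eqP: valA; rewrite b0 addr0 mul1r; apply/negP; exact: pos.
pose s := (Num.sqrt N)^-1.
have s2N : s * (s * N) = 1.
  have sN : Num.sqrt N != 0 by rewrite gt_eqF// sqrtr_gt0.
  by rewrite -(sqr_sqrtr (ltW N_gt0)) /s expr2 mulKf// mulVf.
pose phiK t := s * phi' t.
have bphiK : bounded_mfun phiK by exact: bounded_mfunZ.
have ZphiK x : Z phiK x = s * Z phi' x.
  have b0 := bounded_mfun_cst T (0 : R).
  have Z0 : Z (fun=> 0) x = 0.
    have := @ZDZ (-1) _ _ x b0 b0; rewrite [in RHS]mulN1r subrr => H0; rewrite -[RHS]H0.
    by congr (Z _ _); apply/funext => t; rewrite mulr0 addr0.
  rewrite -[RHS]add0r -Z0 -ZDZ//; congr (Z _ _).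
  by apply/funext => t; rewrite add0r.
(* [B] replaces [C]: it lies in [C], where the old functions are constant, and misses [A], so the
   new function is constant on it too. *)
exists (fun k => if k == K then phiK else phi k), B; split => //.
split => //; split; first by move=> k; case: ifP.
split.
  by move=> k; case: ifP => // _; rewrite meanZ// phi'0 mulr0.
split.
  move=> k; case: ifP => _; last first.
    by have [c cC'] := phiC k; exists c => t /BC; exact: cC'.
  have [c cP] := choice phiC.
  exists (s * (- fine (g A) - \sum_(k < K) e k * c k)) => t Bt.
  rewrite /phiK /phi' /psi indicE memNset => [|At]; last first.
    by have : (A `&` B) t by []; rewrite AB.
  by under eq_bigr do rewrite (cP _ _ (BC _ Bt)); rewrite add0r.
have bZphi k := bZ (bphi k); have bZphi' := bZ bphi'.
have orthK l : (l < K)%N -> \int[Q]_x (Z phiK x * Z (phi l) x) = 0.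
  move=> lK; under eq_Rintegral do rewrite ZphiK -mulrA.
  by rewrite meanZ ?orth ?mulr0//; exact: bounded_mfunM.
move=> k l; rewrite !ltnS (leq_eqVlt k) (leq_eqVlt l); have [->|kK] := eqVneq k K => /=.
  move=> _; have [->|lK /= lK'] := eqVneq l K => /=.
    move=> _; rewrite -s2N.
    under eq_Rintegral do rewrite ZphiK mulrACA -expr2 -expr2.
    rewrite meanZ// -/N; ring.
  exact: orthK.
move=> kK'; have [->|lK] := eqVneq l K => /= [_|lK'].
  under eq_Rintegral do rewrite mulrC.
  by rewrite orthK// (negbTE kK).
exact: zz.
Qed.

End splitting.

(** * Divergence of the likelihood ratio *)

(** Used at [v k = phi k t], to keep the tilted weight nonnegative, and at [v k = z k x], to apply
    [ln1D_ge]. From [|s|^2 <= 2nK] each squared coefficient is at most [K / 32n], whence the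
    [32]. *)
Lemma small_tilt (R : realType) (K : nat) (n B eta : R) (s v : 'I_K -> R) :
  0 < n -> \sum_k s k ^+ 2 <= 2%:R * n * K%:R -> 0 <= eta ->
  K%:R <= 32%:R * n * eta ^+ 2 -> 2%:R * K%:R * eta * B <= 1 ->
  (forall k, `|v k| <= B) -> `|\sum_k s k / (8 * n) * v k| <= 2^-1.
Proof.
move=> n0 sK eta0 Kn etaB vB.
have t_le k : `|s k / (8 * n)| <= eta.
  rewrite -(ler_pXn2r (n := 2))// ?nnegrE// -normrX ger0_norm ?sqr_ge0//.
  rewrite expr_div_n ler_pdivrMr ?exprn_gt0 ?mulr_gt0//.
  have sk : s k ^+ 2 <= 2%:R * n * K%:R.
    apply: le_trans sK; rewrite (bigD1 k)//= lerDl sumr_ge0// => l _.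
    exact: sqr_ge0.
  apply: le_trans sk _.
  have : 2%:R * n * K%:R <= 2%:R * n * (32%:R * n * eta ^+ 2).
    by rewrite ler_wpM2l// mulr_ge0// ltW.
  move=> h; apply: (le_trans h); rewrite le_eqVlt; apply/orP; left; apply/eqP; ring.
apply: le_trans (ler_norm_sum _ _ _) _.
apply: (@le_trans _ _ (\sum_(k < K) eta * B)).
  by apply: ler_sum => k _; rewrite normrM ler_pM.
by rewrite sumr_const card_ord -mulr_natl; lra.
Qed.

Section tilted_likelihood.
Context (R : realType) (d1 d2 d3 : measure_display).
Context (T : measurableType d1) (S : measurableType d2) (Omega : measurableType d3).
Variables (p : T -> S -> R) (g0 : probability T R) (X : nat -> Omega -> S).
Hypothesis p_ge0 : forall t x, 0 <= p t x.
Hypothesis mp : measurable_fun setT (fun xt : S * T => p xt.2 xt.1).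

Local Notation f0 := (mixture p g0).
Local Notation Z := (posterior_mean p g0).

Lemma posterior_mean_sum I (r : seq I) (e : I -> R) (phi : I -> T -> R) x :
  (forall k, bounded_mfun (phi k)) ->
  Z (fun t => \sum_(k <- r) e k * phi k t) x = \sum_(k <- r) e k * Z (phi k) x.
Proof.
move=> bphi; elim: r => [|k r ih].
  under eq_fun do rewrite big_nil.
  by rewrite big_nil (posterior_mean_cst g0 p_ge0 mp) mul0r.
under eq_fun do rewrite big_cons addrC.
have bs : bounded_mfun (fun t => \sum_(l <- r) e l * phi l t).
  by apply: bounded_mfun_sum => l; exact: bounded_mfunZ.
by rewrite (posterior_meanDZ g0 p_ge0 mp _ _ bs (bphi k)) ih big_cons addrC.
Qed.

Lemma loglik_reweighted (phi : T -> R) (g : probability T R) n w :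
  bounded_mfun phi -> (forall t, 0 <= 1 + phi t) ->
  (forall A, measurable A -> (g A = \int[g0]_(t in A) (1 + phi t)%:E)%E) ->
  (forall i, (i < n)%N -> 0 < fine (f0 (X i w))) ->
  (forall i, (i < n)%N -> 0 < 1 + Z phi (X i w)) ->
  loglik X (mixture p g) n w =
  (\sum_(i < n) ln (fine (f0 (X i w))) + \sum_(i < n) ln (1 + Z phi (X i w)))%:E.
Proof.
move=> bphi phi1 gE fX ZX; rewrite /loglik -big_split/= -sumEFin.
apply: eq_bigr => i _.
rewrite (mixture_reweighted p_ge0 mp bphi phi1 gE (fX i (ltn_ord i))).
rewrite lne_EFin ?mulr_gt0 ?fX ?ZX//.
by rewrite lnM ?posrE ?fX ?ZX.
Qed.

(** With [f0] positive and finite at the observations, the subtracted log-likelihood is a real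
    number and no indeterminate difference arises. *)
Lemma loglik_ratio_ge (phi : T -> R) n w :
  bounded_mfun phi -> (forall t, 0 <= 1 + phi t) -> \int[g0]_t phi t = 0 ->
  (forall i, (i < n)%N -> 0 < fine (f0 (X i w))) ->
  (forall i, (i < n)%N -> 0 < 1 + Z phi (X i w)) ->
  ((\sum_(i < n) ln (1 + Z phi (X i w)))%:E <= loglik_ratio X p g0 n w)%E.
Proof.
move=> bphi phi1 phi0 fX ZX.
have b1 := bounded_mfun_cst T (1 : R).
have i1 : \int[g0]_t (1 + phi t) = 1 by rewrite meanD// mean_cst phi0 addr0.
have [g gE] := reweighted_probability (bounded_mfunD b1 bphi) phi1 i1.
have l0 : loglik X f0 n w = (\sum_(i < n) ln (fine (f0 (X i w))))%:E.
  rewrite /loglik -sumEFin; apply: eq_bigr => i _.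
  by rewrite -(mixture_fineK p_ge0 (fX i (ltn_ord i))) lne_EFin// fX.
rewrite /loglik_ratio l0 leeBrDr// -EFinD addrC.
rewrite -(loglik_reweighted bphi phi1 gE fX ZX).
by apply: ereal_sup_ubound; exists g.
Qed.

End tilted_likelihood.

Section divergence.
Context (R : realType) (d1 d2 d3 : measure_display).
Context (T : measurableType d1) (S : measurableType d2) (Omega : measurableType d3).
Variables (mu : {measure set S -> \bar R}) (p : T -> S -> R).
Variables (g0 : probability T R) (P : probability Omega R).
Variable X : nat -> {mfun Omega >-> S}.
Hypothesis p_ge0 : forall t x, 0 <= p t x.
Hypothesis mp : measurable_fun setT (fun xt : S * T => p xt.2 xt.1).
Hypothesis p1 : forall t, (\int[mu]_x (p t x)%:E = 1)%E.
Hypothesis indX : mutually_independent P (fun i => X i : Omega -> S).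
Hypothesis densX : forall i, has_density P mu (mixture p g0) (X i).

Local Notation f0 := (mixture p g0).
Local Notation Z := (posterior_mean p g0).

Let Q : probability S R := distribution P (X 0%N).

Let QE A : measurable A -> (Q A = \int[mu]_(x in A) f0 x)%E.
Proof. exact: densX. Qed.

Let XQ i A : measurable A -> P (X i @^-1` A) = Q A.
Proof. by move=> mA; rewrite densX// QE. Qed.

Let improper : set Omega := \bigcup_i X i @^-1` [set x | ~ 0 < fine (f0 x)].

Let measurable_pre i : measurable (X i @^-1` [set x | ~ 0 < fine (f0 x)]).
Proof.
rewrite -[X in measurable X]setTI; apply: measurable_funPT => //.
exact: (measurable_improper g0 p_ge0 mp).
Qed.

Let m_improper : measurable improper.
Proof. by apply: bigcupT_measurable => i; exact: measurable_pre. Qed.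

Let P_improper : P improper = 0%E.
Proof.
apply/eqP; rewrite -measure_le0.
apply: le_trans (measure_sigma_subadditive _ measurable_pre m_improper (fun x => id)) _.
rewrite eseries0// => i _ _; rewrite [LHS]XQ; last exact: (measurable_improper g0 p_ge0 mp).
exact: (law_improper p_ge0 mp QE).
Qed.

Section scores.
Variables (K : nat) (phi : nat -> T -> R).
Hypothesis K0 : (0 < K)%N.
Hypothesis bphi : forall k, bounded_mfun (phi k).
Hypothesis phi0 : forall k, \int[g0]_t phi k t = 0.
Hypothesis zz : forall k l, (k < K)%N -> (l < K)%N ->
  \int[Q]_x (Z (phi k) x * Z (phi l) x) = (k == l)%:R.

Let z (k : 'I_K) : S -> R := Z (phi k).

Let bz k : bounded_mfun (z k).
Proof. exact: bounded_posterior_mean. Qed.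

Let z0 k : \int[Q]_x z k x = 0.
Proof. by rewrite (mean_posterior_mean p_ge0 mp p1 QE (bphi k)) phi0. Qed.

Let zzK k l : \int[Q]_x (z k x * z l x) = (k == l)%:R.
Proof. by rewrite zz. Qed.

(* If this is less than [1], then [|S|^2] is within [nK / 2] of [nK] and the
   empirical Gram matrix is within Frobenius distance [1] of the identity. *)
Definition deviation n w : R :=
  (2%:R / (n * K)%:R * sqdev X z n w) ^+ 2 + (n%:R ^+ 2)^-1 * gramdev X z n w.

Lemma bounded_deviation n : bounded_mfun (deviation n).
Proof.
have bV := bounded_mfun_past (bounded_sqdev X bz n).
apply: bounded_mfunD; last by apply: bounded_mfunZ; exact: bounded_gramdev.
by apply: bounded_mfunX; exact: bounded_mfunZ.
Qed.

Lemma deviation_ge0 n w : 0 <= deviation n w.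
Proof.
rewrite addr_ge0 ?sqr_ge0// mulr_ge0 ?invr_ge0 ?sqr_ge0//.
by apply: sumr_ge0 => k _; apply: sumr_ge0 => l _; exact: sqr_ge0.
Qed.

Lemma mean_deviation : exists c, forall n, (0 < n)%N ->
  \int[P]_w deviation n w <= 8%:R / K%:R + c / n%:R.
Proof.
exists (4%:R * \int[Q]_x (sqdev1 z x ^+ 2) / K%:R ^+ 2 + gramdev1 Q z) => n n0.
have n0' : 0 < n%:R :> R by rewrite ltr0n.
have K0' : 0 < K%:R :> R by rewrite ltr0n.
have bV := bounded_mfun_past (bounded_sqdev X bz n).
have bG := bounded_gramdev X bz n.
rewrite meanD; last 2 first.
- by apply: bounded_mfunX; exact: bounded_mfunZ.
- exact: bounded_mfunZ.
rewrite meanZ// (mean_gramdev indX XQ bz zzK).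
under eq_Rintegral do rewrite exprMn.
rewrite meanZ; last exact: bounded_mfunX.
rewrite (mean_sqdev_sqr indX XQ bz z0 zzK) natrM.
(* The slack is exactly this term, lost in replacing [n (n - 1)] by [n ^+ 2]. *)
have : 0 <= 8%:R / (n%:R * K%:R) :> R by rewrite divr_ge0// mulr_ge0// ltW.
set C := \int[Q]_x _; set D := gramdev1 _ _.
move=> H; rewrite -subr_ge0; move: H; set lhs := (X in 0 <= X -> _); set rhs := (X in _ -> 0 <= X).
suff -> : rhs = lhs by [].
by rewrite /rhs /lhs; field; rewrite (gt_eqF n0') (gt_eqF K0').
Qed.

(** The threshold depends only on [K] and on the bounds of the scores, not on the sample point. *)
Lemma loglik_ratio_lower : exists N : nat, forall n w, (N < n)%N ->
  (forall i, 0 < fine (f0 (X i w))) -> deviation n w < 1 ->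
  ((K%:R / 32%:R)%:E <= loglik_ratio (fun i => X i) p g0 n w)%E.
Proof.
have [b bP] := choice (fun k => (bphi k).2).
pose B := \sum_(k < K) b k.
have b0 k : 0 <= b k by exact: le_trans (bP k point).
have B0 : 0 <= B by exact: sumr_ge0.
have phiB (k : 'I_K) t : `|phi k t| <= B.
  by apply: le_trans (bP k t) _; rewrite /B (bigD1 k)//= lerDl sumr_ge0.
have zB (k : 'I_K) x : `|z k x| <= B.
  by apply: posterior_mean_le => // t; exact: phiB.
have K0' : 0 < K%:R :> R by rewrite ltr0n.
(* A bound on the tilt coefficients under which [K] scores bounded by [B] sum to at most [1/2]; the
   threshold on [n] below enforces it. *)
pose eta : R := (2%:R * K%:R * (B + 1))^-1.
have eta0 : 0 < eta by rewrite invr_gt0 mulr_gt0 ?mulr_gt0//; lra.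
have etaB : 2%:R * K%:R * eta * B <= 1.
  have -> : 2%:R * K%:R * eta * B = B / (B + 1).
    by rewrite /eta; field; rewrite !gt_eqF//; lra.
  by rewrite ler_pdivrMr ?mul1r; lra.
exists (Num.bound (K%:R / (32%:R * eta ^+ 2))) => n w Nn fX Yn.
have n0 : (0 < n)%N by exact: leq_trans Nn.
have n0' : 0 < n%:R :> R by rewrite ltr0n.
have Kn : K%:R <= 32%:R * n%:R * eta ^+ 2.
  have e2 : 0 < 32%:R * eta ^+ 2 by rewrite mulr_gt0// exprn_gt0.
  rewrite mulrAC mulrC -ler_pdivrMr//.
  apply: le_trans (ltW (archi_boundP _)) _; first by rewrite divr_ge0// ltW.
  by rewrite ler_nat ltnW.
pose s k := \sum_(i < n) z k (X i w).
pose V := \sum_k s k ^+ 2.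
have VE : sqdev X z n w = V - (n * K)%:R by [].
have nK0 : 0 < (n * K)%:R :> R by rewrite ltr0n muln_gt0 n0.
have G0 : 0 <= gramdev X z n w.
  by apply: sumr_ge0 => k _; apply: sumr_ge0 => l _; exact: sqr_ge0.
have Gn : gramdev X z n w <= n%:R ^+ 2.
  rewrite -[leRHS]mul1r -ler_pdivrMr ?exprn_gt0// mulrC.
  by apply: le_trans (ltW Yn); rewrite lerDr sqr_ge0.
have Vn : `|V - (n * K)%:R| <= (n * K)%:R / 2%:R.
  have : (2%:R / (n * K)%:R * sqdev X z n w) ^+ 2 <= 1.
    apply: le_trans (ltW Yn); rewrite lerDl mulr_ge0// invr_ge0 sqr_ge0//.
  rewrite -[X in _ <= X](expr1n _ 2) -ler_sqrt ?expr1n// !sqrtr_sqr ?sqrtr1.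
  rewrite VE normrM gtr0_norm ?divr_gt0// mulrC => H.
  rewrite ler_pdivlMr// mulrC.
  by move: H; rewrite mulrA ler_pdivrMr// mul1r mulrC.
have [V1 V2] : (n * K)%:R / 2%:R <= V /\ V <= 2%:R * n%:R * K%:R.
  by move: Vn; rewrite ler_norml natrM; move: nK0; rewrite natrM => ? ?; split; lra.
pose tilt t := \sum_(k < K) s k / (8 * n%:R) * phi k t.
have btilt : bounded_mfun tilt.
  by apply: bounded_mfun_sum => k; apply: bounded_mfunZ.
have tilt_le t : `|tilt t| <= 2^-1.
  by apply: (small_tilt (B := B) (eta := eta)) => //; exact: ltW.
have tilt1 t : 0 <= 1 + tilt t by have := tilt_le t; rewrite ler_norml; lra.
have tilt0 : \int[g0]_t tilt t = 0.
  rewrite mean_sum => [|k]; last exact: bounded_mfunZ.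
  by rewrite big1// => k _; rewrite meanZ// phi0 mulr0.
have ZE x : Z tilt x = \sum_(k < K) s k / (8 * n%:R) * z k x.
  exact: (posterior_mean_sum g0 p_ge0 mp).
have Z_le x : `|Z tilt x| <= 2^-1.
  by rewrite ZE; apply: (small_tilt (B := B) (eta := eta)) => //; exact: ltW.
apply: le_trans (loglik_ratio_ge p_ge0 mp btilt tilt1 tilt0 _ _) => //; last first.
  by move=> i _; have := Z_le (X i w); rewrite ler_norml; lra.
rewrite lee_fin; under eq_bigr do rewrite ZE.
apply: (@sum_ln_ge R n K (fun i k => z k (X i w))) => // i.
by rewrite -ZE.
Qed.

End scores.

Hypothesis ident : forall g : probability T R,
  chi mu (mixture p g) f0 = 0%E <-> same_law g g0.
Variable E : nat -> set T.
Hypothesis mE : forall i, measurable (E i).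
Hypothesis sepE : forall s t, (forall i, E i s <-> E i t) -> s = t.
Hypothesis gfd : ~ finitely_discrete g0.

Lemma inner_probability_loglik_ratio (M eps : R) : 0 < eps ->
  \forall n \near \oo, ((1 - eps)%:E <=
    inner_probability P [set w | M%:E < loglik_ratio (fun i => X i) p g0 n w])%E.
Proof.
move=> eps0.
(* The first term puts [K / 32] above [M]; the second puts the Chebyshev error [8 / K] below
   [eps / 2]. The remaining [eps / 2] absorbs [c / n]. *)
pose K := (Num.bound (32%:R * `|M| + 16%:R / eps)).+1.
have KM : 32%:R * `|M| + 16%:R / eps < K%:R.
  apply: lt_trans (archi_boundP _) _; last by rewrite ltr_nat.
  by apply: addr_ge0; [exact: mulr_ge0|rewrite divr_ge0// ltW].
have e16 : 0 <= 16%:R / eps by rewrite divr_ge0// ltW.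
have [phi [bphi phi0 zz]] := orthonormal_scores mE sepE
  (bounded_posterior_mean g0 p_ge0 mp)
  (posterior_meanDZ g0 p_ge0 mp)
  (posterior_mean_inj p_ge0 mp QE ident) K gfd.
have K_gt0 : (0 < K)%N by [].
have [N Nlow] := loglik_ratio_lower K_gt0 bphi phi0.
have [c cY] := mean_deviation K_gt0 bphi phi0 zz.
have K0 : 0 < K%:R :> R by rewrite ltr0n.
have H8 : 8%:R / K%:R <= eps / 2%:R.
  rewrite ler_pdivrMr// mulrAC ler_pdivlMr//.
  have : 16%:R / eps < K%:R by apply: le_lt_trans KM; rewrite lerDr mulr_ge0.
  by rewrite ltr_pdivrMr//; lra.
pose N' := Num.bound (2%:R * `|c| / eps).
exists (maxn N N').+1 => // n /= Nn.
have NNn : (N < n)%N by apply: leq_trans Nn; rewrite ltnS leq_maxl.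
have N'n : (N' < n)%N by apply: leq_trans Nn; rewrite ltnS leq_maxr.
have n0 : (0 < n)%N by exact: leq_trans NNn.
have n0' : 0 < n%:R :> R by rewrite ltr0n.
have Hc : c / n%:R <= eps / 2%:R.
  apply: (@le_trans _ _ (`|c| / n%:R)).
    by apply: ler_wpM2r; [rewrite invr_ge0 ltW|exact: ler_norm].
  have : 2%:R * `|c| / eps < n%:R.
    apply: lt_trans (archi_boundP _) _; last by rewrite ltr_nat.
    by apply: divr_ge0; [exact: mulr_ge0|exact: ltW].
  by rewrite ltr_pdivrMr// ler_pdivrMr//; lra.
pose Y := deviation K phi n.
have bY : bounded_mfun Y by exact: bounded_deviation.
have Y0 w : 0 <= Y w by exact: deviation_ge0.
have mY : measurable [set w | 1 <= Y w].
  rewrite (_ : [set w | _] = Y @^-1` `[1, +oo[).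
    by rewrite -[X in measurable X]setTI; exact: bY.1.
  by apply/seteqP; split => w /=; rewrite in_itv/= andbT.
have PY : (P [set w | (1 <= Y w)%R] <= eps%:E)%E.
  apply: le_trans (mean_markov P bY Y0) _; rewrite lee_fin.
  apply: le_trans (cY n n0) _; lra.
pose A := ~` ([set w | 1 <= Y w] `|` improper).
have mA : measurable A by apply: measurableC; exact: measurableU.
apply: (@le_trans _ _ (P A)).
  rewrite probability_setC; last exact: measurableU.
  rewrite EFinB leeB//; apply: le_trans (measureU2 _ mY m_improper) _.
  by have := P_improper; rewrite /= => ->; rewrite adde0.
apply: ereal_sup_ubound; exists A => //; split => // w /not_orP[/negP Yw Iw].
rewrite -ltNge in Yw.
apply: lt_le_trans (Nlow n w NNn _ Yw); last first.
  by move=> i; apply: contrapT => H; apply: Iw; exists i.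
rewrite lte_fin ltr_pdivlMr//; apply: le_lt_trans KM.
have := ler_norm M; lra.
Qed.

Lemma cvg_loglik_ratio (M : R) :
  inner_probability P [set w | (M%:E < loglik_ratio (fun i => X i) p g0 n w)%E]
    @[n --> \oo] --> 1%E.
Proof.
have le1 n : (inner_probability P
    [set w | (M%:E < loglik_ratio (fun i => X i) p g0 n w)%E] <= 1)%E.
  apply: ge_ereal_sup => _ [B [mB _] <-]; exact: probability_le1.
have ge0 n : (0 <= inner_probability P
    [set w | (M%:E < loglik_ratio (fun i => X i) p g0 n w)%E])%E.
  by apply: ereal_sup_ubound; exists set0; [split; [exact: measurable0|exact: sub0set]|exact: measure0].
have fin n : inner_probability P
    [set w | (M%:E < loglik_ratio (fun i => X i) p g0 n w)%E] \is a fin_num.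
  by rewrite ge0_fin_numE//; apply: le_lt_trans (le1 n) (ltry _).
apply/fine_cvgP; split; first exact: nearW.
apply/cvgrPdist_le => eps eps0.
have := inner_probability_loglik_ratio M eps0; apply: filterS => n h.
rewrite /= -lee_fin.
move: h (le1 n) (fin n); case: (inner_probability _ _) => //= r.
rewrite !lee_fin => h1 h2 _; rewrite ger0_norm; lra.
Qed.

End divergence.

(** * Parameter sets in Euclidean space *)

Local Open Scope ereal_scope.

(** Coordinate half-spaces with rational thresholds are countably many and separate points; their
    traces on [Theta] are measurable for the trace sigma-algebra even when [Theta] is not Borel. *)
Lemma paramType_separating (R : realType) (d : nat) (Theta : set 'rV[R]_d)
    (Theta0 : Theta !=set0) : exists E : nat -> set (paramType Theta0),
  (forall i, measurable (E i)) /\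
  (forall s t, (forall i, E i s <-> E i t) -> s = t).
Proof.
pose pv : paramType Theta0 -> 'rV[R]_d := @point_val R d Theta Theta0.
pose half (kq : 'I_d * rat) : set 'rV[R]_d := [set x | x ord0 kq.1 < ratr kq.2]%R.
have open_half kq : open (half kq).
  rewrite (_ : half kq = (fun x : 'rV[R]_d => x ord0 kq.1) @^-1` [set y | y < ratr kq.2]%R)//.
  apply: open_comp; last exact: open_lt.
  by move=> x _; exact: coord_continuous.
(* Integers that code no half-space receive [setT], which separates nothing and does no harm. *)
exists (fun n => if (choice.unpickle n : option ('I_d * rat)) is Some kq then pv @^-1` half kq else setT).
split=> [n|s t st].
  case: (choice.unpickle n : option ('I_d * rat)) => [kq|]; last exact: measurableT.
  exists (half kq); last by rewrite setTI.
  exact: sub_sigma_algebra.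
suff lt_False (u v : paramType Theta0) k :
    (forall kq, half kq (pv u) <-> half kq (pv v)) ->
    ~ (pv u ord0 k < pv v ord0 k)%R.
  have st' kq : half kq (pv s) <-> half kq (pv t).
    by have := st (choice.pickle kq); rewrite choice.pickleK.
  apply: val_inj; apply/rowP => k; apply/eqP; rewrite eq_le !leNgt.
  apply/andP; split; apply/negP.
    exact: (lt_False t s k (fun kq => iff_sym (st' kq))).
  exact: (lt_False s t k st').
move=> uv /rat_in_itvoo[q]; rewrite in_itv/= => /andP[uq qv].
by have := (uv (k, q)).1 uq; rewrite /half/= => /(lt_trans qv); rewrite ltxx.
Qed.

Theorem theorem2p2 (R : realType) (d m : nat)
    (Theta : set 'rV[R]_d) (Theta0 : Theta !=set0)
    (mu : {measure set (borelRV R m) -> \bar R})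
    (p : paramType Theta0 -> borelRV R m -> R)
    (g0 : probability (paramType Theta0) R)
    (dO : measure_display) (Omega : measurableType dO)
    (P : probability Omega R) (X : nat -> Omega -> borelRV R m) :
  bounded_set Theta ->
  (forall t, is_density mu (p t)) ->
  measurable_fun setT
    (fun xt : borelRV R m * paramType Theta0 => p xt.2 xt.1) ->
  ~ finitely_discrete g0 ->
  (forall g : probability (paramType Theta0) R,
     chi mu (mixture p g) (mixture p g0) = 0 <-> same_law g g0) ->
  iid_with_density P X mu (mixture p g0) ->
  forall M : R, (0 < M)%R ->
    inner_probability P [set w | M%:E < loglik_ratio X p g0 n w]
      @[n --> \oo] --> 1.
Proof.
move=> _ dens mp gfd ident [mX densX indX] M _.
have [E [mE sepE]] := paramType_separating Theta0.
pose Y i : {mfun Omega >-> borelRV R m} := HB.pack (X i)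
  (isMeasurableFun.Build _ _ _ _ (X i) (mX i)).
have p_ge0 t x : (0 <= p t x)%R by have [_ + _] := dens t; exact.
have p1 t : \int[mu]_x (p t x)%:E = 1 by have [] := dens t.
exact: (@cvg_loglik_ratio R _ _ _ (paramType Theta0) (borelRV R m) Omega mu p
  g0 P Y p_ge0 mp p1 indX densX ident E mE sepE gfd M).
Qed.
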